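(* Suppose $(\eta,F)$ is a barotropic geodesic on $S^1$ with density $\rho$ and velocity $u$, where the pressure function is $p(\rho)=\rho^3/3$. Consider a Jacobi field $J(t)=(j(t)\circ\eta(t),G(t))$ along $(\eta,F)$ arising from a variation through barotropic geodesics, with initial conditions $J(0)=0$ and $J'(0)=(v_0,0)$. Then, as long as the (smooth) solution exists, for $t\ge0$, $$\|j(t)\|_{L^\infty}\le t\,\|v_0\|_{L^\infty}.$$
   Context: $N=M=S^1$, where $M$ has its standard metric and length form $\mu=dx$, and $N$ has a volume form $\nu$. All objects are $C^\infty$. For an (orientation-preserving) diffeomorphism $\eta:N\to M$, its density $\rho:M\to\mathbb{R}^+$ is defined by $(\rho\circ\eta)\,\eta^*\mu=\nu$; the velocity $u$ of a curve $\eta(t)$ of diffeomorphisms is defined by $\eta_t=u\circ\eta$. Let $\lambda:\mathbb{R}^+\to\mathbb{R}^+$ be smooth, $\varphi(\rho)=\frac12(\lambda(\rho)-\rho\lambda'(\rho))$ and $p(\rho)=\rho^2\varphi(\rho)/\lambda(\rho)^2$; here $\lambda$ is such that $p(\rho)=\rho^3/3$ (e.g. $\lambda(\rho)=3/\rho$). The space $C^\infty(N,M\times\mathbb{R})$ carries the (weak) Riemannian metric $\langle\langle(u\circ\eta,f\circ\eta),(v\circ\eta,g\circ\eta)\rangle\rangle_{(\eta,F)}=\int_{S^1}[\lambda(\rho)fg+\rho uv]\,dx$ at points where $\eta$ is a diffeomorphism. A barotropic geodesic is a geodesic $(\eta(t),F(t))$ whose velocity is $(u\circ\eta,f\circ\eta)$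 with $f=\rho/\lambda(\rho)$; then $u_t+uu_x=-\frac1\rho\,\partial_xp(\rho)$ and $\rho_t+(\rho u)_x=0$. The Jacobi field is $J(t)=\partial_s|_{s=0}\zeta(s,t)$ for a smooth family $\zeta(s,\cdot)=(\overline\eta,\overline F)$ of barotropic geodesics with $\zeta(0,t)=(\eta(t),F(t))$ and $\zeta(s,0)=(\mathrm{id},0)$ for all $s$. With $v=\partial_s|_{s=0}\overline u$ and $\sigma=\partial_s|_{s=0}\overline\rho$ the derivatives of the velocity and density, one has $\sigma=-(\rho j)_x$, $j_t+uj_x-ju_x=v$, $\sigma_t+(\sigma u+\rho v)_x=0$, $v_t+(uv+\sigma\rho)_x=0$, with $j(0,\cdot)=0$, $\sigma(0,\cdot)=0$, $v(0,\cdot)=v_0$. *)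

(* Defs.v *)
From Stdlib Require Import Reals ClassicalEpsilon.
From Coquelicot Require Import Coquelicot.
Open Scope R_scope.

(** Smoothness, uniformly for functions of one, two or three real variables
    (V = R, R * R, R * R * R): iterated directional derivatives in arbitrary
    directions exist and are continuous.  [C_k] is meaningful for open [D]. *)
Fixpoint C_k {V : NormedModule R_AbsRing} (k : nat) (D : V -> Prop)
    (f : V -> R) : Prop :=
  (forall p : V, D p -> continuous f p) /\
  match k with
  | O => True
  | S k' => forall h : V,
      (forall p : V, D p -> ex_derive (fun r : R => f (plus p (scal r h))) 0) /\
      C_k k' D (fun p : V => Derive (fun r : R => f (plus p (scal r h))) 0)
  end.

(** As usual, smooth on a set that need not be open means smooth on some open
    neighbourhood.  Functions are total in Rocq, so a function that is only
    meaningful on [A] is represented by one of its smooth extensions; its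
    derivatives at boundary points of [A] do not depend on the extension for
    the sets [A] used below. *)
Definition smooth_on {V : NormedModule R_AbsRing} (A : V -> Prop)
    (f : V -> R) : Prop :=
  exists U : V -> Prop,
    open U /\ (forall p, A p -> U p) /\ (forall k : nat, C_k k U f).

(** The circle is R / 2 PI Z.  Real functions on it are 2 PI-periodic functions
    on R, and its orientation-preserving diffeomorphisms are given by their
    lifts to R, which commute with the translation by 2 PI. *)
Definition circle_function (g : R -> R) : Prop :=
  smooth_on (fun _ : R => True) g /\ (forall x, g (x + 2 * PI) = g x).

Definition circle_diffeo (eta : R -> R) : Prop :=
  smooth_on (fun _ : R => True) eta /\
  (forall x, eta (x + 2 * PI) = eta x + 2 * PI) /\
  exists theta : R -> R,
    smooth_on (fun _ : R => True) theta /\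
    (forall x, theta (eta x) = x) /\ (forall y, eta (theta y) = y).

(** [nu] stands for the volume form [nu(x) dx] on N. *)
Definition volume_density (nu : R -> R) : Prop :=
  circle_function nu /\ (forall x, 0 < nu x).

(** The inverse map; only meaningful when [eta] is a bijection. *)
Definition inv (eta : R -> R) (y : R) : R :=
  epsilon (inhabits 0) (fun x : R => eta x = y).

(** The solution rho of (rho o eta) eta' = nu. *)
Definition density (nu eta : R -> R) (y : R) : R :=
  nu (inv eta y) / Derive eta (inv eta y).

Definition phi (lambda : R -> R) (r : R) : R :=
  / 2 * (lambda r - r * Derive lambda r).

Definition pressure (lambda : R -> R) (r : R) : R :=
  r ^ 2 * phi lambda r / lambda r ^ 2.

(** A point (eta, F) of C^oo(N, M x R), and a tangent vector at it, both as
    pairs of functions on N. *)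
Definition point : Type := ((R -> R) * (R -> R))%type.
Definition tangent : Type := ((R -> R) * (R -> R))%type.

Definition configuration (P : point) : Prop :=
  circle_diffeo (fst P) /\ circle_function (snd P).

(** For X = (u o eta, f o eta) and Y = (v o eta, g o eta) this is the integral
    over M of lambda(rho) f g + rho u v. *)
Definition metric (nu lambda : R -> R) (P : point) (X Y : tangent) : R :=
  let theta := inv (fst P) in
  let rho := density nu (fst P) in
  RInt (fun y : R =>
          lambda (rho y) * snd X (theta y) * snd Y (theta y)
          + rho y * fst X (theta y) * fst Y (theta y)) 0 (2 * PI).

(** The componentwise time derivative.  It is also applied to a vector field J
    along a curve at a time where J vanishes; there it agrees with the covariant
    derivative, because the Christoffel term is linear in J. *)
Definition velocity (c : R -> (R -> R) * (R -> R)) (t : R) : tangent :=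
  (fun x => Derive (fun tau => fst (c tau) x) t,
   fun x => Derive (fun tau => snd (c tau) x) t).

Definition energy (nu lambda : R -> R) (a b : R) (c : R -> point) : R :=
  RInt (fun t => / 2 * metric nu lambda (c t) (velocity c t) (velocity c t)) a b.

Definition smooth_curve (I : R -> Prop) (c : R -> point) : Prop :=
  smooth_on (fun p : R * R => I (fst p))
    (fun p : R * R => fst (c (fst p)) (snd p)) /\
  smooth_on (fun p : R * R => I (fst p))
    (fun p : R * R => snd (c (fst p)) (snd p)).

Definition smooth_family (eps : R) (I : R -> Prop) (Z : R -> R -> point) : Prop :=
  smooth_on (fun p : R * R * R => Rabs (fst (fst p)) < eps /\ I (snd (fst p)))
    (fun p : R * R * R => fst (Z (fst (fst p)) (snd (fst p))) (snd p)) /\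
  smooth_on (fun p : R * R * R => Rabs (fst (fst p)) < eps /\ I (snd (fst p)))
    (fun p : R * R * R => snd (Z (fst (fst p)) (snd (fst p))) (snd p)).

Definition same_point (P Q : point) : Prop :=
  forall x, fst P x = fst Q x /\ snd P x = snd Q x.

Definition proper_variation (a b eps : R) (c : R -> point)
    (H : R -> R -> point) : Prop :=
  smooth_family eps (fun t => a <= t <= b) H /\
  (forall r t, Rabs r < eps -> a <= t <= b -> configuration (H r t)) /\
  (forall t, a <= t <= b -> same_point (H 0 t) (c t)) /\
  (forall r, Rabs r < eps ->
     same_point (H r a) (c a) /\ same_point (H r b) (c b)).

(** Geodesics on the time interval [0, T): critical points of the energy, on
    every compact subinterval, among curves with the same end points. *)
Definition geodesic (nu lambda : R -> R) (T : R) (c : R -> point) : Prop :=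
  smooth_curve (fun t => 0 <= t < T) c /\
  (forall t, 0 <= t < T -> configuration (c t)) /\
  (forall (a b eps : R) (H : R -> R -> point),
     0 <= a -> a < b -> b < T -> 0 < eps ->
     proper_variation a b eps c H ->
     is_derive (fun r : R => energy nu lambda a b (H r)) 0 0).

(** The second component of the velocity is f o eta with f = rho / lambda(rho). *)
Definition barotropic_geodesic (nu lambda : R -> R) (T : R)
    (c : R -> point) : Prop :=
  geodesic nu lambda T c /\
  (forall t x, 0 <= t < T ->
     snd (velocity c t) x =
       density nu (fst (c t)) (fst (c t) x)
       / lambda (density nu (fst (c t)) (fst (c t) x))).

Definition barotropic_variation (nu lambda : R -> R) (T eps : R)
    (c : R -> point) (Z : R -> R -> point) : Prop :=
  smooth_family eps (fun t => 0 <= t < T) Z /\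
  (forall s, Rabs s < eps -> barotropic_geodesic nu lambda T (Z s)) /\
  (forall t, 0 <= t < T -> same_point (Z 0 t) (c t)) /\
  (forall s, Rabs s < eps -> same_point (Z s 0) (fun x => x, fun _ => 0)).

Definition variation_field (Z : R -> R -> point) (t : R) : tangent :=
  (fun x => Derive (fun s => fst (Z s t) x) 0,
   fun x => Derive (fun s => snd (Z s t) x) 0).

Definition null_set (A : R -> Prop) : Prop :=
  forall eps : R, 0 < eps -> exists a b : nat -> R,
    (forall k, a k <= b k) /\
    (forall x, A x -> exists k, a k < x < b k) /\
    ex_series (fun k => b k - a k) /\ Series (fun k => b k - a k) <= eps.

(** The L^oo norm (essential supremum) of a function on the circle, computed on
    its 2 PI-periodic representative. *)
Definition Linf_norm (g : R -> R) : Rbar :=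
  Glb_Rbar (fun m : R => null_set (fun x => m < Rabs (g x))).

(* Main.v *)
Require Import Defs.
From Stdlib Require Import Reals.
From Coquelicot Require Import Coquelicot.
From Stdlib Require Import Lra Lia Psatz Classical ClassicalEpsilon FunctionalExtensionality.
Open Scope R_scope.

(** In Lagrangian coordinates put r = nu / eta_x and c = r / eta_x.  The first
    variation of the energy along eta + s chi(t) g(x), where g is the
    Euler-Lagrange expression itself at a fixed time, gives eta_tt = - c r_x for
    p = rho^3 / 3; equivalently w = eta_t + r and w' = eta_t - r satisfy
    w_t + c w_x = 0 and w'_t - c w'_x = 0, the Lagrangian form of Burgers'
    equation.  Hence a = eta - t w and b = eta - t w', the feet at time 0 of the
    two characteristics through (t, eta), satisfy a_t + c a_x = 0 and
    b_t - c b_x = 0, and b - a = 2 t r.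

    For the Jacobi field J = eta_s put M = eta_x J_t - eta_xt J.  The linearized
    equation is M_t = (c (r J)_x)_x, and (r J)_t = c M holds identically.  So
    M - (r J)_x and v0(a) a_x solve the same linear conservation law with the
    same initial value, and likewise M + (r J)_x and v0(b) b_x, with the opposite
    speed.  By uniqueness 2 M = v0(a) a_x + v0(b) b_x, so that 2 r J and the
    integral of v0 from a to b have the same time derivative.  They vanish at
    t = 0, hence 2 r |J| <= (b - a) sup |v0| = 2 t r sup |v0|. *)

(** * Smooth functions and directional derivatives *)

(** The pressure [rho^3 / 3] is special because its sound speed, the root of [p'], is [rho] itself:
    the invariants [u + rho] and [u - rho] decouple and each travels at its own value, so
    characteristics are straight and their feet are explicit in [eta], [eta_t] and [r]. Uniqueness
    for a linear equation can then replace the tracing of characteristics. Lagrangian coordinates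
    make every quantity an algebraic expression in [nu] and the derivatives of a single function of
    (s, t, x); in particular, no inverse map has to be differentiated in [s]. A geodesic is given
    only as a critical point of the energy, so the equation of motion has to be extracted from the
    definition. The barotropic relation turns the [lambda] term of the first variation into the
    pressure. The Euler-Lagrange expression at a frozen time, times a polynomial cut-off in time,
    takes the place of bump functions. The equation of motion is obtained for 0 < t < T only;
    initial data enter because the fields are smooth on a neighbourhood of t = 0. *)

Definition smooth {V : NormedModule R_AbsRing} (U : V -> Prop) (f : V -> R) : Prop :=
  forall k : nat, C_k k U f.

(** Convertible with the derivative inside [C_k], so that [smooth_D] is a mere projection. All
    partial derivatives below are values of [D] at basis vectors. *)
Definition D {V : NormedModule R_AbsRing} (h : V) (f : V -> R) (p : V) : R :=
  Derive (fun r : R => f (plus p (scal r h))) 0.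

Lemma Derive_shift (g : R -> R) (x : R) :
  Derive g x = Derive (fun r => g (x + r)) 0.
Proof.
  unfold Derive. f_equal. apply Lim_ext. intros y.
  rewrite Rplus_0_l, Rplus_0_r. reflexivity.
Qed.

Section Calculus.
Context {V : NormedModule R_AbsRing}.
Implicit Types (U : V -> Prop) (f g : V -> R) (h k p : V).

Lemma C_k_pred (n : nat) U f : C_k (S n) U f -> C_k n U f.
Proof.
  revert f; induction n as [|n IH]; intros f [H0 H1].
  - split; auto.
  - split; auto. intros h. destruct (H1 h) as [H2 H3]. split; auto.
Qed.

Lemma C_k_subset (n : nat) (U W : V -> Prop) f :
  (forall p, W p -> U p) -> C_k n U f -> C_k n W f.
Proof.
  intros HW; revert f; induction n as [|n IH]; intros f [H0 H1].
  - split; auto.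
  - split; auto. intros h. destruct (H1 h) as [H2 H3]. split; auto.
Qed.

Lemma plus_scal_0 p h : plus p (scal 0 h) = p.
Proof. rewrite (scal_zero_l (K := R_AbsRing)). apply plus_zero_r. Qed.

Lemma plus_scal_plus p h (r r' : R) :
  plus (plus p (scal r h)) (scal r' h) = plus p (scal (r + r') h).
Proof.
  rewrite <- plus_assoc. f_equal. symmetry. apply (scal_distr_r (K := R_AbsRing) r r' h).
Qed.

Lemma continuous_line p h (r : R) : continuous (fun r : R => plus p (scal r h)) r.
Proof.
  apply (continuous_plus (fun _ : R => p) (fun r : R => scal r h)).
  - apply continuous_const.
  - apply (continuous_scal_l (K := R_AbsRing) (fun r : R => r)). apply continuous_id.
Qed.

Lemma locally_line (P : V -> Prop) p h :
  locally p P -> locally 0 (fun r : R => P (plus p (scal r h))).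
Proof.
  intros H. apply (continuous_line p h 0). rewrite plus_scal_0. exact H.
Qed.

Lemma C_k_ext (n : nat) U f g :
  open U -> (forall p, U p -> f p = g p) -> C_k n U f -> C_k n U g.
Proof.
  intros HU. revert f g; induction n as [|n IH]; intros f g E [H0 H1].
  - split; auto. intros p Hp. apply (continuous_ext_loc _ f).
    + apply filter_imp with (2 := HU p Hp); auto.
    + auto.
  - assert (L : forall h p, U p -> locally 0 (fun r : R =>
       f (plus p (scal r h)) = g (plus p (scal r h)))).
    { intros h p Hp. apply (locally_line (fun q => f q = g q)).
      apply filter_imp with (2 := HU p Hp); auto. }
    split.
    + intros p Hp. apply (continuous_ext_loc _ f).
      * apply filter_imp with (2 := HU p Hp); auto.
      * auto.
    + intros h. destruct (H1 h) as [H2 H3]. split.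
      * intros p Hp. apply ex_derive_ext_loc with (2 := H2 p Hp). apply L; auto.
      * apply (IH (D h f)); auto. intros p Hp. apply Derive_ext_loc. apply L; auto.
Qed.

Lemma smooth_ext U f g :
  open U -> (forall p, U p -> f p = g p) -> smooth U f -> smooth U g.
Proof. intros HU E H n. apply (C_k_ext n U f g); auto. Qed.

Lemma smooth_subset (U W : V -> Prop) f :
  (forall p, W p -> U p) -> smooth U f -> smooth W f.
Proof. intros HW H n. apply C_k_subset with U; auto. Qed.

Lemma smooth_continuous U f p : smooth U f -> U p -> continuous f p.
Proof. intros H. apply (H 0%nat). Qed.

Lemma smooth_D U f h : smooth U f -> smooth U (D h f).
Proof. intros H n. apply (proj2 (H (S n)) h). Qed.

Lemma is_derive_D U f h p :
  smooth U f -> U p -> is_derive (fun r : R => f (plus p (scal r h))) 0 (D h f p).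
Proof. intros H Hp. apply Derive_correct. apply (proj2 (H 1%nat) h); auto. Qed.

Lemma is_derive_line U f h p (r : R) :
  smooth U f -> U (plus p (scal r h)) ->
  is_derive (fun r : R => f (plus p (scal r h))) r (D h f (plus p (scal r h))).
Proof.
  intros H Hp.
  apply (is_derive_ext (fun z : R => f (plus (plus p (scal r h)) (scal (z - r) h)))).
  { intros t. rewrite plus_scal_plus. do 3 f_equal. ring. }
  evar_last.
  - apply (is_derive_comp (fun z : R => f (plus (plus p (scal r h)) (scal z h)))
      (fun z : R => z - r)).
    + replace (r - r) with 0 by ring. eapply is_derive_D; eauto.
    + auto_derive; auto.
  - unfold scal; simpl; unfold mult; simpl. ring.
Qed.

Lemma D_ext U f g h p :
  open U -> (forall q, U q -> f q = g q) -> U p -> D h f p = D h g p.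
Proof.
  intros HU E Hp. apply Derive_ext_loc. apply (locally_line (fun q => f q = g q)).
  apply filter_imp with (2 := HU p Hp); auto.
Qed.

Lemma C_k_const (n : nat) U (c : R) : C_k n U (fun _ : V => c).
Proof.
  revert c; induction n as [|n IH]; intros c; split; auto;
    try (intros; apply continuous_const).
  intros h; split.
  - intros; apply (ex_derive_const (K := R_AbsRing) (V := R_NormedModule)).
  - replace (fun p : V => _) with (fun _ : V => 0); auto.
      apply functional_extensionality. intros p; symmetry; apply Derive_const.
Qed.

Lemma C_k_plus (n : nat) U f g :
  open U -> C_k n U f -> C_k n U g -> C_k n U (fun p => f p + g p).
Proof.
  intros HU. revert f g; induction n as [|n IH]; intros f g [F0 F1] [G0 G1].
  - split; auto. intros p Hp. apply (continuous_plus (V := R_NormedModule) f g); auto.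
  - split.
    + intros p Hp. apply (continuous_plus (V := R_NormedModule) f g); auto.
    + intros h. destruct (F1 h) as [F2 F3], (G1 h) as [G2 G3]. split.
      * intros p Hp. apply (ex_derive_plus (V := R_NormedModule)); auto.
      * apply (C_k_ext n U (fun p => D h f p + D h g p)); auto.
        intros p Hp. unfold D. rewrite Derive_plus; auto.
Qed.

Lemma C_k_mult (n : nat) U f g :
  open U -> C_k n U f -> C_k n U g -> C_k n U (fun p => f p * g p).
Proof.
  intros HU. revert f g; induction n as [|n IH]; intros f g Hf Hg.
  - split; auto. intros p Hp. destruct Hf, Hg.
    apply (continuous_mult (K := R_AbsRing) f g); auto.
  - pose proof (C_k_pred _ _ _ Hf). pose proof (C_k_pred _ _ _ Hg).
    destruct Hf as [F0 F1], Hg as [G0 G1]. split.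
    + intros p Hp. apply (continuous_mult (K := R_AbsRing) f g); auto.
    + intros h. destruct (F1 h) as [F2 F3], (G1 h) as [G2 G3]. split.
      * intros p Hp. apply ex_derive_mult; auto.
      * apply (C_k_ext n U (fun p => D h f p * g p + f p * D h g p)); auto.
        -- intros p Hp. unfold D. rewrite Derive_mult; auto. now rewrite !plus_scal_0.
        -- apply C_k_plus; auto.
Qed.

End Calculus.

(** * Chain rule, rules for directional derivatives, mixed derivatives *)

Section Composition.
Context {V : NormedModule R_AbsRing}.
Implicit Types (U : V -> Prop) (f g : V -> R) (h k p : V).

(** An outer function of one variable suffices, since operations of two arguments are handled by
    sums and products. The derivative is [D h f] times [D 1 g] after [f], so the induction closes
    through [C_k_mult]. *)
Lemma C_k_comp (n : nat) U (W : R -> Prop) f (g : R -> R) :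
  open U -> (forall p, U p -> W (f p)) -> C_k n U f -> C_k n W g ->
  C_k n U (fun p => g (f p)).
Proof.
  intros HU HW. revert f g HW; induction n as [|n IH]; intros f g HW Hf Hg.
  - split; auto. intros p Hp. destruct Hf, Hg. apply continuous_comp; auto.
  - pose proof (C_k_pred _ _ _ Hf). pose proof (C_k_pred _ _ _ Hg).
    destruct Hf as [F0 F1], Hg as [G0 G1]. split.
    + intros p Hp. apply continuous_comp; auto.
    + assert (Gd : forall x, W x -> ex_derive g x /\ D 1 g x = Derive g x).
      { intros x Hx. destruct (G1 1) as [G2 _]. specialize (G2 x Hx). split.
        - apply (ex_derive_ext (fun z => g (plus x (scal (z - x) (1:R))))).
          + intros t. f_equal. unfold plus, scal; simpl; unfold mult; simpl. ring.
          + apply (ex_derive_comp (V := R_NormedModule)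
             (fun z => g (plus x (scal z (1:R)))) (fun z => z - x)).
            * replace (x - x) with 0 by ring. exact G2.
            * auto_derive; auto.
        - unfold D. rewrite (Derive_shift g x). apply Derive_ext. intros t.
          f_equal. unfold plus, scal; simpl; unfold mult; simpl. ring. }
      intros h. destruct (F1 h) as [F2 F3], (G1 1) as [G2 G3]. split.
      * intros p Hp. apply (ex_derive_comp (V := R_NormedModule) g).
        -- rewrite plus_scal_0. apply Gd; auto.
        -- auto.
      * apply (C_k_ext n U (fun p => D h f p * D 1 g (f p))); auto.
        -- intros p Hp.
           rewrite (Derive_comp g (fun r => f (plus p (scal r h)))); rewrite ?plus_scal_0.
           ++ rewrite (proj2 (Gd _ (HW p Hp))). reflexivity.
           ++ apply Gd; auto.
           ++ auto.
        -- apply C_k_mult; auto.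
Qed.

Lemma smooth_const U (c : R) : smooth U (fun _ => c).
Proof. intros n; apply C_k_const. Qed.

Lemma smooth_plus U f g :
  open U -> smooth U f -> smooth U g -> smooth U (fun p => f p + g p).
Proof. intros HU Hf Hg n; apply C_k_plus; auto. Qed.

Lemma smooth_mult U f g :
  open U -> smooth U f -> smooth U g -> smooth U (fun p => f p * g p).
Proof. intros HU Hf Hg n; apply C_k_mult; auto. Qed.

Lemma smooth_opp U f : open U -> smooth U f -> smooth U (fun p => - f p).
Proof.
  intros HU Hf. apply (smooth_ext U (fun p => (-1) * f p)); auto.
  - intros; ring.
  - apply smooth_mult; auto. apply smooth_const.
Qed.

Lemma smooth_minus U f g :
  open U -> smooth U f -> smooth U g -> smooth U (fun p => f p - g p).
Proof. intros HU Hf Hg; apply smooth_plus; auto; apply smooth_opp; auto. Qed.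

Lemma smooth_comp U (W : R -> Prop) f (g : R -> R) :
  open U -> (forall p, U p -> W (f p)) -> smooth U f -> smooth W g ->
  smooth U (fun p => g (f p)).
Proof. intros HU HW Hf Hg n. apply C_k_comp with W; auto. Qed.

Lemma D_const h (c : R) p : D h (fun _ => c) p = 0.
Proof. exact (Derive_const c 0). Qed.

Lemma D_plus U f g h p :
  smooth U f -> smooth U g -> U p -> D h (fun q => f q + g q) p = D h f p + D h g p.
Proof.
  intros Hf Hg Hp. unfold D. rewrite Derive_plus; auto.
  - exists (D h f p); eapply is_derive_D; eauto.
  - exists (D h g p); eapply is_derive_D; eauto.
Qed.

Lemma D_opp f h p : D h (fun q => - f q) p = - D h f p.
Proof. exact (Derive_opp _ 0). Qed.

Lemma D_minus U f g h p :
  smooth U f -> smooth U g -> U p -> D h (fun q => f q - g q) p = D h f p - D h g p.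
Proof.
  intros Hf Hg Hp. unfold D. rewrite Derive_minus; auto.
  - exists (D h f p); eapply is_derive_D; eauto.
  - exists (D h g p); eapply is_derive_D; eauto.
Qed.

Lemma D_mult U f g h p :
  smooth U f -> smooth U g -> U p ->
  D h (fun q => f q * g q) p = D h f p * g p + f p * D h g p.
Proof.
  intros Hf Hg Hp. unfold D. rewrite Derive_mult, !plus_scal_0; auto.
  - exists (D h f p); eapply is_derive_D; eauto.
  - exists (D h g p); eapply is_derive_D; eauto.
Qed.

(** Restricting [f] to the plane through p spanned by h and k reduces the claim to Schwarz's theorem
    in two real variables. *)
Lemma D_comm U f h k p :
  open U -> smooth U f -> U p -> D h (D k f) p = D k (D h f) p.
Proof.
  intros HU Hf Hp.
  set (L := fun u v : R => plus (plus p (scal u h)) (scal v k)).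
  assert (L' : forall u v : R, L u v = plus (plus p (scal v k)) (scal u h)).
  { intros u v. unfold L. rewrite <- !plus_assoc. f_equal. apply plus_comm. }
  assert (CL : forall z : R * R, continuous (fun z : R * R => L (fst z) (snd z)) z).
  { intros z. unfold L.
    apply (continuous_plus (fun z : R * R => plus p (scal (fst z) h))
             (fun z : R * R => scal (snd z) k)).
    - apply (continuous_plus (fun z : R * R => p) (fun z : R * R => scal (fst z) h)).
      + apply continuous_const.
      + apply (continuous_scal_l (K := R_AbsRing) (fun z : R * R => fst z)). apply continuous_fst.
    - apply (continuous_scal_l (K := R_AbsRing) (fun z : R * R => snd z)). apply continuous_snd. }
  assert (DL : forall g u v, Derive (fun t => g (L t v)) u = D h g (L u v) /\
                        Derive (fun t => g (L u t)) v = D k g (L u v)).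
  { intros g u v. split; rewrite Derive_shift; apply Derive_ext; intros t; f_equal.
    - rewrite !L'. symmetry. apply plus_scal_plus.
    - symmetry. apply plus_scal_plus. }
  assert (EL : forall g u v, smooth U g -> U (L u v) ->
      ex_derive (fun t => g (L t v)) u /\ ex_derive (fun t => g (L u t)) v).
  { intros g u v Hg HL. split.
    - rewrite L' in HL.
      apply ex_derive_ext with (fun t => g (plus (plus p (scal v k)) (scal t h))).
      + intros t; now rewrite L'.
      + eexists; eapply is_derive_line; eauto.
    - eexists; eapply is_derive_line; eauto. }
  assert (L0 : L 0 0 = p) by (unfold L; now rewrite !plus_scal_0).
  assert (EQ : forall g, Derive (fun z => Derive (fun t => g (L z t)) 0) 0 = D h (D k g) p /\
                 Derive (fun z => Derive (fun t => g (L t z)) 0) 0 = D k (D h g) p).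
  { intros g. rewrite <- L0. split.
    - rewrite <- (proj1 (DL (D k g) 0 0)). apply Derive_ext. intros t. apply DL.
    - rewrite <- (proj2 (DL (D h g) 0 0)). apply Derive_ext. intros t. apply DL. }
  rewrite <- (proj1 (EQ f)), <- (proj2 (EQ f)).
  apply (Schwarz (fun u v => f (L u v))).
  - apply locally_2d_locally.
    apply filter_imp with (fun z : R * R => U (L (fst z) (snd z))).
    + intros [u v] Hz; cbn [fst snd] in *. split; [|split; [|split]].
      * apply (EL f u v); auto.
      * apply (EL f u v); auto.
      * apply ex_derive_ext with (fun z => D k f (L z v)).
        -- intros t; symmetry; apply (DL f t v).
        -- apply (EL (D k f) u v); auto using smooth_D.
      * apply ex_derive_ext with (fun z => D h f (L u z)).
        -- intros t; symmetry; apply (DL f u t).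
        -- apply (EL (D h f) u v); auto using smooth_D.
    + apply (CL (0, 0)). simpl. rewrite L0. auto.
  - apply continuity_2d_pt_filterlim.
    apply continuous_ext with (fun z : R * R => D h (D k f) (L (fst z) (snd z))).
    { intros [u v]; simpl. rewrite <- (proj1 (DL (D k f) u v)).
      apply Derive_ext; intros t; symmetry; apply DL. }
    apply (continuous_comp (fun z : R * R => L (fst z) (snd z))); [apply CL|].
    simpl. rewrite L0. apply smooth_continuous with U; auto using smooth_D.
  - apply continuity_2d_pt_filterlim.
    apply continuous_ext with (fun z : R * R => D k (D h f) (L (fst z) (snd z))).
    { intros [u v]; simpl. rewrite <- (proj2 (DL (D h f) u v)).
      apply Derive_ext; intros t; symmetry; apply DL. }
    apply (continuous_comp (fun z : R * R => L (fst z) (snd z))); [apply CL|].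
    simpl. rewrite L0. apply smooth_continuous with U; auto using smooth_D.
Qed.

End Composition.

(** * Affine changes of variables, reciprocals, derivatives along lines *)

Section Affine.
Context {V W : NormedModule R_AbsRing}.
Variables L L0 : V -> W.
Hypothesis L_cont : forall p, continuous L p.
Hypothesis L_line : forall p h (r : R), L (plus p (scal r h)) = plus (L p) (scal r (L0 h)).

(** [L0] is the linear part of [L]: composing with [L] only changes the direction of
    differentiation, so no product rule arises. It serves projections, sections and slices alike. *)
Lemma C_k_affine (n : nat) (U : W -> Prop) (f : W -> R) :
  C_k n U f -> C_k n (fun p => U (L p)) (fun p => f (L p)).
Proof.
  revert f; induction n as [|n IH]; intros f [H0 H1].
  - split; auto. intros p Hp. apply continuous_comp; auto.
  - split.
    + intros p Hp. apply continuous_comp; auto.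
    + intros h. destruct (H1 (L0 h)) as [H2 H3]. split.
      * intros p Hp. apply ex_derive_ext with (2 := H2 _ Hp).
        intros t; now rewrite L_line.
      * replace (fun p : V => Derive _ 0) with (fun p : V => D (L0 h) f (L p)).
        -- apply IH; auto.
        -- apply functional_extensionality; intros p. apply Derive_ext.
           intros t; now rewrite L_line.
Qed.

Lemma smooth_affine (U : W -> Prop) (f : W -> R) :
  smooth U f -> smooth (fun p => U (L p)) (fun p => f (L p)).
Proof. intros H n; apply C_k_affine; auto. Qed.

Lemma D_affine (f : W -> R) (h p : V) : D h (fun q => f (L q)) p = D (L0 h) f (L p).
Proof. apply Derive_ext; intros t; now rewrite L_line. Qed.

End Affine.

Lemma smooth_id : smooth (fun _ : R => True) (fun x : R => x).
Proof.
  intros n. destruct n as [|n]; (split; [intros; apply continuous_id|auto]).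
  assert (E : forall h p : R, is_derive (fun r : R => plus p (scal r h)) 0 h).
  { intros h p. unfold plus, scal; simpl; unfold mult; simpl. auto_derive; auto. ring. }
  intros h; split.
  - intros p _. eexists; apply E.
  - replace (fun p : R => _) with (fun _ : R => h); [apply C_k_const|].
    apply functional_extensionality; intros p. symmetry. apply is_derive_unique, E.
Qed.

Lemma open_neq0 : open (fun x : R => x <> 0).
Proof. apply open_neq. Qed.

(** The derivative of the reciprocal is a constant times a product of two reciprocals, so [C_k] at
    one order gives the next. *)
Lemma smooth_Rinv : smooth (fun x : R => x <> 0) Rinv.
Proof.
  intros n; induction n as [|n IH].
  - split; auto. intros; apply continuous_Rinv; auto.
  - assert (E : forall h p : R, p <> 0 ->
      is_derive (fun r : R => / (plus p (scal r h))) 0 (- h * (/ p * / p))).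
    { intros h p Hp. unfold plus, scal; simpl; unfold mult; simpl. auto_derive.
      - now rewrite Rmult_0_l, Rplus_0_r.
      - field; rewrite ?Rmult_0_l, ?Rplus_0_r; auto. }
    split; [intros; apply continuous_Rinv; auto|].
    intros h; split.
    + intros p Hp. eexists; apply E; auto.
    + apply (C_k_ext n _ (fun p : R => - h * (/ p * / p))); [apply open_neq0| |].
      * intros p Hp. symmetry. apply is_derive_unique, E; auto.
      * apply C_k_mult; [apply open_neq0|apply C_k_const|].
        apply C_k_mult; auto using open_neq0.
Qed.

Lemma smooth_inv {V : NormedModule R_AbsRing} (U : V -> Prop) (f : V -> R) :
  open U -> (forall p, U p -> f p <> 0) -> smooth U f -> smooth U (fun p => / f p).
Proof. intros HU Hf H. apply (smooth_comp U (fun x => x <> 0) f Rinv); auto using smooth_Rinv. Qed.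

(** Turns a partial derivative, with the other coordinates held fixed, into a value of [D]: moving
    one coordinate is a straight line with direction h. *)
Lemma Derive_path {V : NormedModule R_AbsRing} (f : V -> R) (g : R -> V) (h : V) (x : R) :
  (forall r, g (x + r) = plus (g x) (scal r h)) ->
  Derive (fun y => f (g y)) x = D h f (g x).
Proof.
  intros H. rewrite Derive_shift. apply Derive_ext. intros r; now rewrite H.
Qed.

Lemma is_derive_path {V : NormedModule R_AbsRing} (U : V -> Prop) (f : V -> R)
    (g : R -> V) (h : V) (x : R) :
  smooth U f -> U (g x) ->
  (forall r, g (x + r) = plus (g x) (scal r h)) ->
  is_derive (fun y => f (g y)) x (D h f (g x)).
Proof.
  intros Hf Hx H. pose proof (is_derive_D U f h _ Hf Hx) as E.
  apply (is_derive_ext (fun z : R => f (plus (g x) (scal (z - x) h)))).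
  { intros t. rewrite <- H. do 2 f_equal. ring. }
  evar_last.
  - apply (is_derive_comp (fun z : R => f (plus (g x) (scal z h))) (fun z : R => z - x)).
    + replace (x - x) with 0 by ring. exact E.
    + auto_derive; auto.
  - unfold scal; simpl; unfold mult; simpl. ring.
Qed.

Lemma smooth_fst {V : NormedModule R_AbsRing} (U : V -> Prop) (f : V -> R) :
  smooth U f -> smooth (fun p : V * R => U (fst p)) (fun p => f (fst p)).
Proof.
  intros Hf. apply (smooth_affine (V := prod_NormedModule R_AbsRing V R_NormedModule) fst fst); auto.
  intros []; apply continuous_fst.
Qed.

Lemma smooth_snd {V : NormedModule R_AbsRing} (U : R -> Prop) (f : R -> R) :
  smooth U f -> smooth (fun p : V * R => U (snd p)) (fun p => f (snd p)).
Proof.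
  intros Hf. apply (smooth_affine (V := prod_NormedModule R_AbsRing V R_NormedModule)
    (W := R_NormedModule) snd snd); auto.
  intros []; apply continuous_snd.
Qed.

Lemma smooth_section {V : NormedModule R_AbsRing} (U : V * R -> Prop) (f : V * R -> R) (p : V) :
  smooth U f -> smooth (fun x : R => U (p, x)) (fun x => f (p, x)).
Proof.
  intros Hf. apply (smooth_affine (W := prod_NormedModule R_AbsRing V R_NormedModule)
    (fun x : R => (p, x)) (fun x : R => (zero, x))); auto.
  - intros x P [d Hd]. exists d. intros y Hy. apply Hd. split; auto. apply ball_center.
  - intros x h r. apply (f_equal2 pair); auto.
    exact (eq_sym (eq_trans (f_equal (plus p)
      (scal_zero_r (V := NormedModule.ModuleSpace R_AbsRing V) r)) (plus_zero_r p))).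
Qed.

(** * Compactness of intervals and rectangles *)

(** Compactness of an interval as an induction principle: a relation that can be concatenated and
    that holds on all short pieces holds on the whole. The proof looks at the supremum of the c with
    [Q a c]. Applied below to tubes, bounds and covers alike. *)
Lemma interval_induction (Q : R -> R -> Prop) (a b : R) :
  a <= b ->
  (forall u v w, u <= v -> v <= w -> Q u v -> Q v w -> Q u w) ->
  (forall x, a <= x <= b -> exists d, 0 < d /\
     forall u v, a <= u -> u <= v -> v <= b -> x - d < u -> v < x + d -> Q u v) ->
  Q a b.
Proof.
  intros Hab Htrans Hloc.
  set (E := fun c => a <= c <= b /\ Q a c).
  assert (Ea : E a).
  { split; [lra|]. destruct (Hloc a) as [d [Hd H]]; [lra|]. apply H; lra. }
  destruct (completeness E) as [m [Hm1 Hm2]].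
  { exists b. intros c [Hc _]; lra. }
  { exists a; auto. }
  assert (Hma : a <= m) by (apply Hm1; auto).
  assert (Hmb : m <= b) by (apply Hm2; intros c [Hc _]; lra).
  destruct (Hloc m) as [d [Hd H]]; [lra|].
  assert (exists c, E c /\ m - d < c) as [c [[Hc Qc] Hcd]].
  { apply NNPP; intros N. assert (m <= m - d); [|lra].
    apply Hm2. intros c Hc. apply Rnot_lt_le; intros Hlt. apply N; exists c; auto. }
  assert (Hcm : c <= m) by (apply Hm1; split; auto).
  assert (Hq : forall w, c <= w <= b -> w < m + d -> Q a w).
  { intros w Hw Hw'. apply Htrans with c; try lra; auto. apply H; lra. }
  destruct (Req_dec m b) as [->|Hne].
  - apply Hq; lra.
  - assert (Rmin b (m + d / 2) <= m).
    { apply Hm1. pose proof (Rmin_l b (m + d/2)). pose proof (Rmin_r b (m + d/2)).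
      assert (m < Rmin b (m + d / 2)) by (apply Rmin_glb_lt; lra).
      split; [lra|]. apply Hq; lra. }
    assert (m < Rmin b (m + d / 2)) by (apply Rmin_glb_lt; lra). lra.
Qed.

Lemma locally_prod_inv {T : UniformSpace} (P : T -> R -> Prop) (p0 : T) (x : R) :
  locally (p0, x) (fun z : T * R => P (fst z) (snd z)) ->
  exists d, 0 < d /\ locally p0 (fun p => forall y, x - d < y < x + d -> P p y).
Proof.
  intros [d Hd]. exists d. split; [apply cond_pos|]. exists d. intros p Hp y Hy.
  apply (Hd (p, y)). split; simpl; auto.
  apply Rabs_def1; unfold minus, plus, opp; simpl; lra.
Qed.

(** The tube lemma: neighbourhoods of the points of a compact segment contain a common product
    neighbourhood. *)
Lemma locally_forall_interval {T : UniformSpace} (P : T -> R -> Prop) (p0 : T) (a b : R) :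
  (forall x, a <= x <= b -> locally (p0, x) (fun z : T * R => P (fst z) (snd z))) ->
  locally p0 (fun p => forall x, a <= x <= b -> P p x).
Proof.
  intros H. destruct (Rle_or_lt a b) as [Hab|Hab].
  - apply (interval_induction
      (fun u v => locally p0 (fun p => forall x, u <= x <= v -> P p x))); auto.
    + intros u v w Huv Hvw H1 H2. generalize (filter_and _ _ H1 H2).
      apply filter_imp. intros p [Q1 Q2] x Hx.
      destruct (Rle_or_lt x v); [apply Q1|apply Q2]; lra.
    + intros x Hx. destruct (locally_prod_inv P p0 x (H x Hx)) as [d [Hd Hp]].
      exists d; split; auto. intros u v _ _ _ Hu Hv.
      apply filter_imp with (2 := Hp). intros p Hq y Hy. apply Hq; lra.
  - apply filter_forall. intros p x Hx; lra.
Qed.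

Lemma locally_bounded_interval {T : UniformSpace} (f : T -> R -> R) (p0 : T) (a b : R) :
  (forall x, a <= x <= b ->
     exists K, locally (p0, x) (fun z : T * R => Rabs (f (fst z) (snd z)) <= K)) ->
  exists K, locally p0 (fun p => forall x, a <= x <= b -> Rabs (f p x) <= K).
Proof.
  intros H. destruct (Rle_or_lt a b) as [Hab|Hab].
  - apply (interval_induction (fun u v => exists K, locally p0
      (fun p => forall x, u <= x <= v -> Rabs (f p x) <= K))); auto.
    + intros u v w Huv Hvw [K1 H1] [K2 H2]. exists (Rmax K1 K2).
      generalize (filter_and _ _ H1 H2).
      apply filter_imp. intros p [Q1 Q2] x Hx.
      destruct (Rle_or_lt x v).
      * apply Rle_trans with K1; [apply Q1; lra|apply Rmax_l].
      * apply Rle_trans with K2; [apply Q2; lra|apply Rmax_r].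
    + intros x Hx. destruct (H x Hx) as [K HK].
      destruct (locally_prod_inv (fun p x => Rabs (f p x) <= K) p0 x HK) as [d [Hd Hp]].
      exists d; split; auto. intros u v _ _ _ Hu Hv. exists K.
      apply filter_imp with (2 := Hp). intros p Hq y Hy. apply Hq; lra.
  - exists 0. apply filter_forall. intros p x Hx; lra.
Qed.

Lemma continuous_locally_bounded {T : UniformSpace} (f : T -> R) (p : T) :
  continuous f p -> locally p (fun q => Rabs (f q) <= Rabs (f p) + 1).
Proof.
  intros H. specialize (H (fun y => Rabs y <= Rabs (f p) + 1)). apply H.
  exists (mkposreal 1 Rlt_0_1). intros y Hy.
  assert (Rabs (y - f p) < 1) by exact Hy.
  pose proof (Rabs_triang_inv y (f p)). lra.
Qed.

Definition continuous2 (f : R -> R -> R) (t x : R) : Prop :=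
  continuous (fun z : R * R => f (fst z) (snd z)) (t, x).

Lemma bounded_rectangle (f : R -> R -> R) (a b c d : R) :
  (forall t x, a <= t <= b -> c <= x <= d -> continuous2 f t x) ->
  exists K, forall t x, a <= t <= b -> c <= x <= d -> Rabs (f t x) <= K.
Proof.
  intros H. destruct (Rle_or_lt a b) as [Hab|Hab].
  - apply (interval_induction (fun u v => exists K,
      forall t x, u <= t <= v -> c <= x <= d -> Rabs (f t x) <= K)); auto.
    + intros u v w Huv Hvw [K1 H1] [K2 H2]. exists (Rmax K1 K2). intros t x Ht Hx.
      destruct (Rle_or_lt t v).
      * apply Rle_trans with K1; [apply H1; lra|apply Rmax_l].
      * apply Rle_trans with K2; [apply H2; lra|apply Rmax_r].
    + intros t Ht. destruct (locally_bounded_interval f t c d) as [K [e He]].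
      { intros x Hx. eexists. apply (continuous_locally_bounded _ _ (H t x Ht Hx)). }
      exists e; split; [apply cond_pos|]. intros u v _ _ _ Hu Hv. exists K.
      intros t' x Ht'. apply He. apply Rabs_def1; unfold minus, plus, opp; simpl; lra.
  - exists 0. intros; lra.
Qed.

(* If the supremum [M] were not attained, [1 / (M - f)] would be continuous, hence bounded. *)
Lemma max_rectangle (f : R -> R -> R) (a b c d : R) :
  a <= b -> c <= d ->
  (forall t x, a <= t <= b -> c <= x <= d -> continuous2 f t x) ->
  exists t x, a <= t <= b /\ c <= x <= d /\
    forall t' x', a <= t' <= b -> c <= x' <= d -> f t' x' <= f t x.
Proof.
  intros Hab Hcd H. destruct (bounded_rectangle f a b c d H) as [K HK].
  set (E := fun y => exists t x, a <= t <= b /\ c <= x <= d /\ y = f t x).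
  destruct (completeness E) as [M [HM1 HM2]].
  { exists K. intros y (t & x & Ht & Hx & ->).
    pose proof (HK t x Ht Hx). pose proof (Rle_abs (f t x)). lra. }
  { exists (f a c), a, c. repeat split; lra. }
  apply NNPP; intros N.
  assert (HM : forall t x, a <= t <= b -> c <= x <= d -> f t x < M).
  { intros t x Ht Hx. assert (f t x <= M) by (apply HM1; exists t, x; auto).
    destruct (Req_dec (f t x) M) as [E1|E1]; [|lra]. exfalso; apply N.
    exists t, x. repeat split; try lra. intros. rewrite E1. apply HM1; exists t', x'; auto. }
  destruct (bounded_rectangle (fun t x => / (M - f t x)) a b c d) as [B HB].
  { intros t x Ht Hx. apply continuous_comp_2 with (h := fun m y => / (m - y)) (f := fun _ => M).
    - apply continuous_const.
    - apply H; auto.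
    - apply (continuous_comp (fun z : R * R => fst z - snd z) Rinv).
      + apply (continuous_minus (V := R_NormedModule) (@fst R R) (@snd R R)).
        * apply continuous_fst.
        * apply continuous_snd.
      + apply continuous_Rinv. simpl. specialize (HM t x Ht Hx). lra. }
  assert (HB0 : 0 < B).
  { pose proof (HB a c ltac:(lra) ltac:(lra)). pose proof (HM a c ltac:(lra) ltac:(lra)).
    assert (0 < / (M - f a c)) by (apply Rinv_0_lt_compat; lra).
    rewrite Rabs_right in * by lra. lra. }
  assert (M <= M - / B); [|pose proof (Rinv_0_lt_compat B HB0); lra].
  apply HM2. intros y (t & x & Ht & Hx & ->).
  pose proof (HB t x Ht Hx). pose proof (HM t x Ht Hx).
  assert (0 < / (M - f t x)) by (apply Rinv_0_lt_compat; lra).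
  rewrite Rabs_right in * by lra.
  assert (/ B <= M - f t x); [|lra].
  rewrite <- (Rinv_inv (M - f t x)). apply Rinv_le_contravar; auto.
Qed.

(** By the tube lemma [f p] is uniformly close to [f p0] on the segment, hence so are the
    integrals. *)
Lemma continuous_RInt_param {T : UniformSpace} (f : T -> R -> R) (p0 : T) (a b : R) :
  a <= b ->
  (forall x, a <= x <= b -> continuous (fun z : T * R => f (fst z) (snd z)) (p0, x)) ->
  locally p0 (fun p => ex_RInt (f p) a b) ->
  continuous (fun p => RInt (f p) a b) p0.
Proof.
  intros Hab Hc Hex. apply filterlim_locally. intros e.
  (* The summand 1 keeps the denominator positive when a = b, and the factor 2 makes
     [(b - a) * e' < e] strict. *)
  set (e' := e / (2 * (b - a + 1))).
  assert (He' : 0 < e') by (apply Rdiv_lt_0_compat; [apply cond_pos|lra]).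
  assert (Hc0 : forall x, a <= x <= b -> continuous (f p0) x).
  { intros x Hx.
    apply (continuous_comp (fun x : R => (p0, x)) (fun z : T * R => f (fst z) (snd z))); auto.
    intros P [d Hd]. exists d. intros y Hy. apply Hd. split; auto. apply ball_center. }
  assert (Hex0 : ex_RInt (f p0) a b) by (apply locally_singleton with (1 := Hex)).
  assert (HT : locally p0 (fun p => forall x, a <= x <= b -> Rabs (f p x - f p0 x) < e')).
  { apply (locally_forall_interval (fun p x => Rabs (f p x - f p0 x) < e')).
    intros x Hx.
    assert (G : continuous (fun z : T * R => f (fst z) (snd z) - f p0 (snd z)) (p0, x)).
    { apply (continuous_minus (V := R_NormedModule)
        (fun z : T * R => f (fst z) (snd z)) (fun z : T * R => f p0 (snd z))); auto.
      apply (continuous_comp (fun z : T * R => snd z) (f p0)).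
      - apply continuous_snd.
      - apply Hc0; auto. }
    specialize (G (fun y => Rabs y < e')). apply G. simpl.
    exists (mkposreal e' He'). intros y Hy. replace y with (y - (f p0 x - f p0 x)) by ring.
    exact Hy. }
  generalize (filter_and _ _ HT Hex). apply filter_imp. intros p [H1 H2].
  assert (E : RInt (f p) a b - RInt (f p0) a b = RInt (fun x => f p x - f p0 x) a b).
  { symmetry. apply (RInt_minus (V := R_CompleteNormedModule)); auto. }
  assert (Rabs (RInt (f p) a b - RInt (f p0) a b) < e); [|assumption].
  rewrite E. apply Rle_lt_trans with ((b - a) * e').
  - apply abs_RInt_le_const; auto.
    + apply (ex_RInt_minus (V := R_NormedModule)); auto.
    + intros t Ht. left; auto.
  - assert (e' * (2 * (b - a + 1)) = e) by (unfold e'; field; lra).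
    pose proof (cond_pos e). nra.
Qed.

(** * Null sets and the essential supremum *)

(** For a <= b, the length of the part of (a, b) to the left of x. *)
Definition length_below (a b x : R) : R := Rmax 0 (Rmin x b - a).

Lemma length_below_incr (a b u v : R) : u <= v -> length_below a b u <= length_below a b v.
Proof. intros H. unfold length_below, Rmax, Rmin. repeat destruct Rle_dec; lra. Qed.

(** A cover of total length at most half of d - c is refuted: by interval induction finitely many of
    its members already account for the length v - u of each subinterval, since increments of
    [length_below] add up. *)
Lemma interval_not_null (A : R -> Prop) (c d : R) :
  null_set A -> c < d -> ~ (forall x, c <= x <= d -> A x).
Proof.
  intros HA Hcd Hall. destruct (HA ((d - c) / 2)) as (a & b & Hab & Hcov & Hex & Hsum); [lra|].
  assert (exists n, forall N, (n <= N)%nat ->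
    d - c <= sum_f_R0 (fun k => length_below (a k) (b k) d - length_below (a k) (b k) c) N) as [n Hn].
  { apply (interval_induction (fun u v => exists n, forall N, (n <= N)%nat ->
      v - u <= sum_f_R0 (fun k => length_below (a k) (b k) v - length_below (a k) (b k) u) N)); [lra| |].
    - intros u v w _ _ [n1 H1] [n2 H2]. exists (max n1 n2). intros N HN.
      specialize (H1 N ltac:(lia)). specialize (H2 N ltac:(lia)).
      replace (sum_f_R0 _ N) with
       (sum_f_R0 (fun k => length_below (a k) (b k) v - length_below (a k) (b k) u) N +
        sum_f_R0 (fun k => length_below (a k) (b k) w - length_below (a k) (b k) v) N); [lra|].
      rewrite <- sum_plus. apply sum_eq. intros; ring.
    - intros x Hx. destruct (Hcov x (Hall x Hx)) as [k Hk].
      exists (Rmin (x - a k) (b k - x)). split; [apply Rmin_glb_lt; lra|].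
      intros u v Hu Huv Hv Hxu Hxv. exists k. intros N HN.
      pose proof (Rmin_l (x - a k) (b k - x)). pose proof (Rmin_r (x - a k) (b k - x)).
      assert (G : forall i, 0 <= length_below (a i) (b i) v - length_below (a i) (b i) u).
      { intros i. pose proof (length_below_incr (a i) (b i) u v Huv). lra. }
      apply Rle_trans with (length_below (a k) (b k) v - length_below (a k) (b k) u).
      (* Both u and v lie in the covering interval number k, which alone contributes exactly v -
         u. *)
      + unfold length_below. rewrite !Rmin_left, !Rmax_right by lra. lra.
      + clear - HN G. induction HN as [|N HN IH].
        * destruct k as [|k]; simpl; [lra|].
          assert (0 <= sum_f_R0 (fun k0 => length_below (a k0) (b k0) v - length_below (a k0) (b k0) u) k).
          { apply cond_pos_sum; auto. } lra.
        * simpl. specialize (G (S N)). lra. }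
  specialize (Hn n (le_n _)).
  assert (sum_f_R0 (fun k => length_below (a k) (b k) d - length_below (a k) (b k) c) n
          <= sum_f_R0 (fun k => b k - a k) n).
  { apply sum_Rle. intros k _. specialize (Hab k).
    unfold length_below, Rmax, Rmin. repeat destruct Rle_dec; lra. }
  assert (sum_f_R0 (fun k => b k - a k) n <= Series (fun k => b k - a k)).
  { apply sum_incr.
    - apply is_series_Reals. apply Series_correct; auto.
    - intros k. specialize (Hab k). lra. }
  lra.
Qed.

(** A continuous function exceeding m in absolute value at one point does so on an interval, and
    intervals are not null. *)
Lemma null_set_bound (g : R -> R) (m : R) :
  (forall x, continuous g x) -> null_set (fun x => m < Rabs (g x)) ->
  forall x, Rabs (g x) <= m.
Proof.
  intros Hg Hn x. apply Rnot_lt_le; intros Hlt.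
  assert (L : locally x (fun y => m < Rabs (g y))).
  { apply (continuous_comp g Rabs x (Hg x) (continuous_Rabs _) (fun y => m < y)).
    apply (open_gt m (Rabs (g x))); auto. }
  destruct L as [e He]. pose proof (cond_pos e).
  apply (interval_not_null _ (x - e / 2) (x + e / 2) Hn); [lra|].
  intros y Hy. apply He. apply Rabs_def1; unfold minus, plus, opp; simpl; lra.
Qed.

Lemma null_set_empty (A : R -> Prop) : (forall x, ~ A x) -> null_set A.
Proof.
  intros HA e He. exists (fun _ => 0), (fun _ => 0). split; [|split; [|split]].
  - intros; lra.
  - intros x Hx; destruct (HA x Hx).
  - exists 0. apply is_series_Reals. intros e' He'. exists 0%nat. intros n _.
    rewrite sum_eq_R0 by (intros; ring). now rewrite R_dist_eq.
  - rewrite (Series_ext _ (fun n => 0 * 0)) by (intros; ring).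
    rewrite Series_scal_l. lra.
Qed.

Lemma Linf_norm_le (g : R -> R) (m : R) :
  (forall x, Rabs (g x) <= m) -> Rbar_le (Linf_norm g) (Finite m).
Proof.
  intros H. apply (Glb_Rbar_correct (fun m => null_set (fun x => m < Rabs (g x)))).
  apply null_set_empty. intros x Hx. specialize (H x). lra.
Qed.

(** The case t = 0 has its own hypothesis: if [g] were unbounded the last hypothesis would say
    nothing, while 0 times infinity is 0 in [Rbar]. *)
Lemma Linf_norm_scale (f g : R -> R) (t : R) :
  0 <= t -> (forall x, continuous g x) ->
  (t = 0 -> forall x, f x = 0) ->
  (forall m, (forall x, Rabs (g x) <= m) -> forall x, Rabs (f x) <= t * m) ->
  Rbar_le (Linf_norm f) (Rbar_mult (Finite t) (Linf_norm g)).
Proof.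
  intros Ht Hg H0 H.
  destruct (Req_dec t 0) as [->|Hne].
  - assert (E : Rbar_mult (Finite 0) (Linf_norm g) = Finite 0) by apply Rbar_mult_0_l.
    rewrite E. apply Linf_norm_le. intros x. rewrite H0, Rabs_R0; auto; lra.
  - assert (Ht' : 0 < t) by lra.
    assert (G : forall m, null_set (fun x => m < Rabs (g x)) ->
              Rbar_le (Linf_norm f) (Finite (t * m))).
    { intros m Hm. apply Linf_norm_le. apply H. now apply null_set_bound. }
    destruct (Glb_Rbar_correct (fun m => null_set (fun x => m < Rabs (g x)))) as [G1 G2].
    fold (Linf_norm g) in G1, G2.
    destruct (Linf_norm f) as [lf| |] eqn:Ef.
    + assert (Gl : Rbar_le (Finite (lf / t)) (Linf_norm g)).
      { apply G2. intros m Hm. specialize (G m Hm). simpl in *.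
        apply Rmult_le_reg_l with t; auto. replace (t * (lf / t)) with lf by (field; auto). auto. }
      destruct (Linf_norm g) as [lg| |]; simpl in Gl.
      * simpl. apply Rmult_le_compat_l with (r := t) in Gl; auto.
        replace (t * (lf / t)) with lf in Gl by (field; auto). auto.
      * rewrite Rbar_mult_comm. replace (Rbar_mult p_infty (Finite t)) with p_infty; simpl; auto.
        destruct (Rle_dec 0 t); [|lra]. destruct (Rle_lt_or_eq_dec 0 t r); auto; lra.
      * destruct Gl.
    + assert (Gl : Rbar_le p_infty (Linf_norm g)).
      { apply G2. intros m Hm. destruct (G m Hm). }
      destruct (Linf_norm g) as [lg| |]; simpl in Gl; try tauto.
      rewrite Rbar_mult_comm. replace (Rbar_mult p_infty (Finite t)) with p_infty; simpl; auto.
      destruct (Rle_dec 0 t); [|lra]. destruct (Rle_lt_or_eq_dec 0 t r); auto; lra.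
    + simpl; auto.
Qed.

(** * Circle diffeomorphisms *)

Definition everywhere {T : Type} (_ : T) : Prop := True.

Lemma smooth_on_smooth {V : NormedModule R_AbsRing} (A : V -> Prop) (f : V -> R) :
  (forall p, A p) -> smooth_on A f -> smooth everywhere f.
Proof.
  intros HA (U & _ & HU & Hf). apply smooth_subset with U; auto.
Qed.

Lemma smooth_smooth_on {V : NormedModule R_AbsRing} (A : V -> Prop) (f : V -> R) :
  smooth everywhere f -> smooth_on A f.
Proof.
  intros H. exists everywhere. split; [|split]; auto.
  - apply open_true.
  - intros; exact I.
Qed.

Lemma open_everywhere {T : UniformSpace} : open (@everywhere T).
Proof. apply open_true. Qed.

Lemma smooth_continuity_pt (f : R -> R) (x : R) :
  smooth everywhere f -> continuity_pt f x.
Proof.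
  intros H. apply continuity_pt_filterlim. exact (smooth_continuous everywhere f x H I).
Qed.

Lemma smooth_is_derive (f : R -> R) (x : R) :
  smooth everywhere f -> is_derive f x (Derive f x).
Proof.
  intros H. evar_last.
  - apply (is_derive_path everywhere f (fun y => y) 1 x H I).
    intros r. unfold plus, scal; simpl; unfold mult; simpl. ring.
  - symmetry. apply (Derive_path f (fun y => y)).
    intros r. unfold plus, scal; simpl; unfold mult; simpl. ring.
Qed.

Lemma D_1_Derive (f : R -> R) : D 1 f = Derive f.
Proof.
  apply functional_extensionality; intros x. symmetry. apply (Derive_path f (fun y => y)).
  intros r. unfold plus, scal; simpl; unfold mult; simpl. ring.
Qed.

Lemma smooth_Derive (f : R -> R) :
  smooth everywhere f -> smooth everywhere (Derive f).
Proof. intros H. rewrite <- D_1_Derive. now apply smooth_D. Qed.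

Lemma D_Derive (f : R -> R) (h x : R) :
  smooth everywhere f -> D h f x = h * Derive f x.
Proof.
  intros H. apply is_derive_unique.
  evar_last.
  - apply (is_derive_comp f (fun r => plus x (scal r h))).
    + apply smooth_is_derive; auto.
    + unfold plus, scal; simpl; unfold mult; simpl. auto_derive; auto.
  - unfold plus, scal; simpl; unfold mult; simpl. rewrite Rmult_0_l, Rplus_0_r. ring.
Qed.

Section Inverse.
Variable eta : R -> R.
Hypothesis eta_smooth : smooth everywhere eta.
Hypothesis eta_period : forall x, eta (x + 2 * PI) = eta x + 2 * PI.
Hypothesis eta_pos : forall x, 0 < Derive eta x.

Lemma lift_increasing x y : x < y -> eta x < eta y.
Proof.
  intros Hxy. destruct (MVT_gen eta x y (Derive eta)) as (c & Hc & E).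
  - intros; apply smooth_is_derive; auto.
  - intros z _. apply smooth_continuity_pt; auto.
  - pose proof (eta_pos c). nra.
Qed.

Lemma lift_injective x y : eta x = eta y -> x = y.
Proof.
  intros E. destruct (Rtotal_order x y) as [H|[H|H]]; auto;
   apply lift_increasing in H; lra.
Qed.

(** Commuting with the translation by one period makes [eta] unbounded in both directions; the
    intermediate value theorem does the rest. *)
Lemma lift_surjective y : exists x, eta x = y.
Proof.
  assert (E : forall n, eta (INR n * (2 * PI)) = eta 0 + INR n * (2 * PI) /\
                        eta (- (INR n * (2 * PI))) = eta 0 - INR n * (2 * PI)).
  { induction n as [|n [IH1 IH2]].
    - simpl. rewrite !Rmult_0_l, Ropp_0. split; ring.
    - rewrite S_INR. split.
      + replace ((INR n + 1) * (2 * PI)) with (INR n * (2 * PI) + 2 * PI) by ring.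
        rewrite eta_period, IH1. ring.
      + pose proof (eta_period (- ((INR n + 1) * (2 * PI)))) as P.
        replace (- ((INR n + 1) * (2 * PI)) + 2 * PI) with (- (INR n * (2 * PI))) in P by ring.
        rewrite IH2 in P. lra. }
  pose proof PI_RGT_0.
  destruct (INR_unbounded (Rabs (y - eta 0) / (2 * PI))) as [n Hn].
  destruct (E n) as [E1 E2].
  assert (Hy : Rabs (y - eta 0) <= INR n * (2 * PI)).
  { apply Rmult_le_reg_r with (/ (2 * PI)); [apply Rinv_0_lt_compat; lra|].
    replace (INR n * (2 * PI) * / (2 * PI)) with (INR n) by (field; lra).
    unfold Rdiv in Hn. lra. }
  apply Rabs_le_between in Hy.
  destruct (IVT_gen eta (- (INR n * (2 * PI))) (INR n * (2 * PI)) y) as (x & _ & Hx).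
  - intros z. apply smooth_continuity_pt; auto.
  - rewrite E1, E2. split.
    + apply Rle_trans with (1 := Rmin_l _ _). lra.
    + apply Rle_trans with (2 := Rmax_r _ _). lra.
  - exists x; auto.
Qed.

Lemma lift_inv y : eta (inv eta y) = y.
Proof. apply (epsilon_spec (inhabits 0) (fun x => eta x = y)), lift_surjective. Qed.

Lemma inv_lift x : inv eta (eta x) = x.
Proof. apply lift_injective, lift_inv. Qed.

Lemma inv_between (y u v : R) : eta u < y < eta v -> u < inv eta y < v.
Proof.
  intros [H1 H2]. rewrite <- (lift_inv y) in H1, H2. split; apply Rnot_le_lt; intros H.
  - destruct H as [H|H]; [apply lift_increasing in H|rewrite H in H1]; lra.
  - destruct H as [H|H]; [apply lift_increasing in H|rewrite H in H2]; lra.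
Qed.

Lemma continuous_inv_lift y : continuous (inv eta) y.
Proof.
  apply filterlim_locally. intros e. pose proof (cond_pos e).
  set (x := inv eta y).
  assert (H1 : eta (x - e) < y) by (rewrite <- (lift_inv y); apply lift_increasing; fold x; lra).
  assert (H2 : y < eta (x + e)) by (rewrite <- (lift_inv y); apply lift_increasing; fold x; lra).
  assert (Hd : 0 < Rmin (y - eta (x - e)) (eta (x + e) - y)) by (apply Rmin_glb_lt; lra).
  exists (mkposreal _ Hd). intros z Hz.
  assert (Hz' : Rabs (z - y) < Rmin (y - eta (x - e)) (eta (x + e) - y)) by exact Hz.
  apply Rabs_def2 in Hz'.
  pose proof (Rmin_l (y - eta (x - e)) (eta (x + e) - y)).
  pose proof (Rmin_r (y - eta (x - e)) (eta (x + e) - y)).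
  destruct (inv_between z (x - e) (x + e)); [lra|].
  apply Rabs_def1; unfold minus, plus, opp; simpl; fold x; lra.
Qed.

(** By the mean value theorem the difference quotient of the inverse equals [/ Derive eta c]
    exactly, with c caught between two values of the continuous inverse. *)
Lemma is_derive_inv_lift y : is_derive (inv eta) y (/ Derive eta (inv eta y)).
Proof.
  set (x := inv eta y). apply is_derive_Reals. intros e He.
  assert (C : continuous (fun z => / Derive eta z) x).
  { apply continuous_Rinv_comp.
    - exact (smooth_continuous everywhere _ x (smooth_Derive _ eta_smooth) I).
    - pose proof (eta_pos x); lra. }
  destruct (proj1 (filterlim_locally (fun z => / Derive eta z) (/ Derive eta x)) C (mkposreal e He))
    as [d Hd].
  destruct (proj1 (filterlim_locally (inv eta) x) (continuous_inv_lift y) d) as [d' Hd'].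
  exists d'. intros h Hh0 Hh.
  assert (Hk : Rabs (inv eta (y + h) - x) < d).
  { apply Hd'. unfold ball; simpl; unfold AbsRing_ball, abs, minus, plus, opp; simpl.
    replace (y + h + - y) with h by ring. auto. }
  destruct (MVT_gen eta x (inv eta (y + h)) (Derive eta)) as (c & Hc & E).
  - intros; apply smooth_is_derive; auto.
  - intros z _. apply smooth_continuity_pt; auto.
  - rewrite lift_inv in E. unfold x in E at 1. rewrite lift_inv in E.
    replace (y + h - y) with h in E by ring.
    pose proof (eta_pos c).
    replace ((inv eta (y + h) - inv eta y) / h) with (/ Derive eta c).
    + apply Hd. unfold ball; simpl; unfold AbsRing_ball, abs, minus, plus, opp; simpl.
      apply Rle_lt_trans with (2 := Hk).
      unfold Rmin, Rmax in Hc. apply Rabs_le_between.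
      destruct (Rle_dec x (inv eta (y + h))); [rewrite Rabs_right|rewrite Rabs_left]; lra.
    + fold x. replace (inv eta (y + h) - x) with (h / Derive eta c); [field; lra|].
      rewrite E at 1. field; lra.
Qed.

(** Bootstrap: the derivative of the inverse is a smooth function of the inverse, so each order of
    regularity gives the next. *)
Lemma smooth_inv_lift : smooth everywhere (inv eta).
Proof.
  intros n; induction n as [|n IH].
  - split; auto. intros; apply continuous_inv_lift.
  - assert (E : forall h p : R, is_derive (fun r : R => inv eta (plus p (scal r h))) 0
       (h * / Derive eta (inv eta p))).
    { intros h p. evar_last.
      - apply (is_derive_comp (inv eta) (fun r => plus p (scal r h))).
        + apply is_derive_inv_lift.
        + unfold plus, scal; simpl; unfold mult; simpl. auto_derive; auto.
      - unfold plus, scal; simpl; unfold mult; simpl. rewrite Rmult_0_l, Rplus_0_r. ring. }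
    split; [intros; apply continuous_inv_lift|].
    intros h; split.
    + intros p _. eexists; apply E.
    + apply (C_k_ext n _ (fun p : R => h * / Derive eta (inv eta p))); [apply open_true| |].
      * intros p _. symmetry. apply is_derive_unique, E.
      * apply C_k_mult; [apply open_true|apply C_k_const|].
        apply (C_k_comp n everywhere everywhere (inv eta) (fun x => / Derive eta x));
          auto using open_everywhere.
        apply smooth_inv; auto using open_everywhere, smooth_Derive.
        intros p _. pose proof (eta_pos p). lra.
Qed.

Lemma circle_diffeo_intro : circle_diffeo eta.
Proof.
  split; [apply smooth_smooth_on; auto|]. split; auto.
  exists (inv eta). split; [apply smooth_smooth_on, smooth_inv_lift|].
  split; [apply inv_lift|apply lift_inv].
Qed.

Lemma inv_lift_period y : inv eta (y + 2 * PI) = inv eta y + 2 * PI.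
Proof. apply lift_injective. now rewrite eta_period, !lift_inv. Qed.

End Inverse.

Lemma Derive_period (f : R -> R) (c : R) :
  (forall x, f (x + 2 * PI) = f x + c) ->
  forall x, Derive f (x + 2 * PI) = Derive f x.
Proof.
  intros Hf x. rewrite !(Derive_shift f). unfold Derive. f_equal. apply Lim_ext. intros h.
  replace (x + 2 * PI + (0 + h)) with (x + (0 + h) + 2 * PI) by ring.
  replace (x + 2 * PI + 0) with (x + 0 + 2 * PI) by ring.
  rewrite !Hf. f_equal. ring.
Qed.

(** The smooth inverse forbids zeros of the derivative, and the mean value theorem over one period
    gives a point where it equals 1; by the intermediate value theorem it is positive everywhere. *)
Lemma circle_diffeo_elim (eta : R -> R) :
  circle_diffeo eta ->
  smooth everywhere eta /\ (forall x, eta (x + 2 * PI) = eta x + 2 * PI) /\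
  (forall x, 0 < Derive eta x).
Proof.
  intros (H1 & H2 & theta & H3 & H4 & H5).
  apply smooth_on_smooth in H1; auto. apply smooth_on_smooth in H3; auto.
  split; [auto|split; [auto|]].
  assert (N : forall x, Derive eta x <> 0).
  { intros x E.
    assert (E1 : Derive (fun z => theta (eta z)) x = 1).
    { rewrite (Derive_ext _ (fun z => z)) by auto. apply Derive_id. }
    rewrite Derive_comp in E1.
    - rewrite E in E1. lra.
    - eexists; apply smooth_is_derive; auto.
    - eexists; apply smooth_is_derive; auto. }
  assert (Cd : forall x, continuity_pt (Derive eta) x).
  { intros x. apply smooth_continuity_pt, smooth_Derive; auto. }
  pose proof PI_RGT_0.
  destruct (MVT_gen eta 0 (0 + 2 * PI) (Derive eta)) as (c & Hc & E).
  - intros; apply smooth_is_derive; auto.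
  - intros z _. apply smooth_continuity_pt; auto.
  - rewrite H2 in E. assert (Derive eta c = 1) by nra.
    intros x. apply Rnot_le_lt; intros Hx.
    destruct (IVT_gen (Derive eta) c x 0) as (z & _ & Hz); auto.
    + split; [apply Rle_trans with (1 := Rmin_r _ _); lra|
              apply Rle_trans with (2 := Rmax_l _ _); lra].
    + apply (N z); auto.
Qed.

(** * Integrals depending on parameters *)

Lemma pair_line {V : NormedModule R_AbsRing} (p h : V) (x u r : R) :
  (plus p (scal (u + r) h), x) = plus (plus p (scal u h), x) (scal r (h, (zero : R))).
Proof.
  change ((plus p (scal (u + r) h), x) = (plus (plus p (scal u h)) (scal r h), x + r * 0)).
  rewrite plus_scal_plus. f_equal. ring.
Qed.

Section ParametricIntegral.
Context {V : NormedModule R_AbsRing}.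
Variables (U : V * R -> Prop) (a b : R).
Hypothesis U_open : open U.
Hypothesis a_le_b : a <= b.

(** Parameters whose entire segment lies in [U]; open by the tube lemma, which lets smoothness of
    the integral make sense there. *)
Let below (p : V) : Prop := forall x, a <= x <= b -> U (p, x).

Lemma open_below : open below.
Proof.
  intros p Hp. apply (locally_forall_interval (fun p x => U (p, x))).
  intros x Hx. apply filter_imp with (2 := U_open _ (Hp x Hx)). intros [q y]; auto.
Qed.

Lemma continuous_section (f : V * R -> R) (p : V) (x : R) :
  continuous f (p, x) -> continuous (fun x => f (p, x)) x.
Proof.
  intros H. apply (continuous_comp (fun x : R => (p, x)) f); auto.
  intros P [d Hd]. exists d. intros y Hy. apply Hd. split; auto. apply ball_center.
Qed.

Lemma ex_RInt_section (f : V * R -> R) (p : V) :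
  (forall q, U q -> continuous f q) -> below p -> ex_RInt (fun x => f (p, x)) a b.
Proof.
  intros Hf Hp. apply (ex_RInt_continuous (V := R_CompleteNormedModule)).
  rewrite Rmin_left, Rmax_right by auto. intros x Hx. apply continuous_section. auto.
Qed.

Lemma continuous_RInt_section (f : V * R -> R) (p : V) :
  (forall q, U q -> continuous f q) -> below p ->
  continuous (fun p => RInt (fun x => f (p, x)) a b) p.
Proof.
  intros Hf Hp. apply (continuous_RInt_param (fun p x => f (p, x))); auto.
  - intros x Hx. apply continuous_ext with f; [intros []; auto|auto].
  - apply filter_imp with (2 := open_below p Hp). intros; now apply ex_RInt_section.
Qed.

Lemma is_derive_RInt_section (f : V * R -> R) (h p : V) :
  smooth U f -> below p ->
  is_derive (fun r : R => RInt (fun x => f (plus p (scal r h), x)) a b) 0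
    (RInt (fun x => D (h, zero) f (p, x)) a b).
Proof.
  intros Hf Hp.
  assert (E : forall u v, Derive (fun z : R => f (plus p (scal z h), v)) u
                     = D (h, zero) f (plus p (scal u h), v)).
  { intros u v. apply (Derive_path f (fun z => (plus p (scal z h), v))). intros r.
    apply pair_line. }
  assert (L : locally 0 (fun r : R => below (plus p (scal r h)))).
  { apply locally_line, open_below, Hp. }
  evar_last.
  - apply (is_derive_RInt_param (fun r x => f (plus p (scal r h), x))).
    + apply filter_imp with (2 := L). intros r Hr x. rewrite Rmin_left, Rmax_right by auto.
      intros Hx. eexists.
      apply (is_derive_path U f (fun z => (plus p (scal z h), x)) (h, zero)); auto.
      intros s. apply pair_line.
    + intros x. rewrite Rmin_left, Rmax_right by auto. intros Hx.
      apply continuity_2d_pt_filterlim.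
      apply continuous_ext with
        (fun z : R * R => D (h, zero) f (plus p (scal (fst z) h), snd z)).
      { intros [u v]; symmetry; apply E. }
      apply (continuous_comp_2 (fun z : R * R => plus p (scal (fst z) h)) (fun z => snd z)
        (fun q y => D (h, zero) f (q, y))).
      * apply (continuous_comp fst (fun r : R => plus p (scal r h))).
        -- apply continuous_fst.
        -- apply continuous_line.
      * apply continuous_snd.
      * simpl. rewrite plus_scal_0.
        apply continuous_ext with (D (h, zero) f); [intros []; auto|].
        apply smooth_continuous with U; auto using smooth_D.
    + apply filter_imp with (2 := L). intros r Hr. apply ex_RInt_section; auto.
      intros q Hq; apply smooth_continuous with U; auto.
  - apply RInt_ext. intros x _. rewrite E, plus_scal_0. reflexivity.
Qed.

(** Differentiation under the integral replaces [f] by [D (h, zero) f], again smooth on [U], so the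
    induction hypothesis applies to it. *)
Lemma smooth_RInt (f : V * R -> R) :
  smooth U f -> smooth below (fun p => RInt (fun x => f (p, x)) a b).
Proof.
  intros Hf n. revert f Hf; induction n as [|n IH]; intros f Hf; split; auto;
    try (intros p Hp; apply continuous_RInt_section; auto;
         intros q Hq; now apply (smooth_continuous U)).
  intros h; split.
  - intros p Hp. eexists. now apply is_derive_RInt_section.
  - apply (C_k_ext n _ (fun p => RInt (fun x => D (h, zero) f (p, x)) a b)).
    + apply open_below.
    + intros p Hp. symmetry. apply is_derive_unique. now apply is_derive_RInt_section.
    + apply IH. now apply smooth_D.
Qed.

Lemma D_RInt (f : V * R -> R) (h p : V) :
  smooth U f -> (forall x, a <= x <= b -> U (p, x)) ->
  D h (fun p => RInt (fun x => f (p, x)) a b) p = RInt (fun x => D (h, zero) f (p, x)) a b.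
Proof. intros Hf Hp. apply is_derive_unique. now apply is_derive_RInt_section. Qed.

End ParametricIntegral.

(** * Periodic functions and the metric in Lagrangian coordinates *)

Lemma periodic_extend (P : R -> Prop) :
  (forall x, P x -> P (x + 2 * PI)) -> (forall x, P x -> P (x - 2 * PI)) ->
  (forall x, 0 <= x <= 2 * PI -> P x) -> forall x, P x.
Proof.
  intros Hp Hm H0. pose proof PI_RGT_0.
  assert (G : forall n x, - (INR n * (2 * PI)) <= x <= INR n * (2 * PI) + 2 * PI -> P x).
  { induction n as [|n IH]; intros x.
    - simpl. rewrite Rmult_0_l. intros; apply H0; lra.
    - rewrite S_INR. intros Hx.
      destruct (Rlt_or_le x (- (INR n * (2 * PI)))).
      + replace x with (x + 2 * PI - 2 * PI) by ring. apply Hm, IH.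
        pose proof (pos_INR n). nra.
      + destruct (Rlt_or_le (INR n * (2 * PI) + 2 * PI) x).
        * replace x with (x - 2 * PI + 2 * PI) by ring. apply Hp, IH.
          pose proof (pos_INR n). nra.
        * apply IH; lra. }
  intros x. destruct (INR_unbounded (Rabs x / (2 * PI))) as [n Hn].
  apply (G n).
  assert (Hy : Rabs x <= INR n * (2 * PI)).
  { apply Rmult_le_reg_r with (/ (2 * PI)); [apply Rinv_0_lt_compat; lra|].
    replace (INR n * (2 * PI) * / (2 * PI)) with (INR n) by (field; lra).
    unfold Rdiv in Hn. lra. }
  apply Rabs_le_between in Hy. lra.
Qed.

Lemma RInt_periodic (f : R -> R) (c : R) :
  (forall x, continuous f x) -> (forall x, f (x + 2 * PI) = f x) ->
  RInt f c (c + 2 * PI) = RInt f 0 (2 * PI).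
Proof.
  intros Hf Hp.
  assert (Ex : forall a b, ex_RInt f a b).
  { intros; apply (ex_RInt_continuous (V := R_CompleteNormedModule)); auto. }
  assert (E : RInt f (2 * PI) (c + 2 * PI) = RInt f 0 c).
  { pose proof (RInt_comp_lin f 1 (2 * PI) 0 c (Ex _ _)) as E.
    replace (1 * 0 + 2 * PI) with (2 * PI) in E by ring.
    replace (1 * c + 2 * PI) with (c + 2 * PI) in E by ring.
    rewrite <- E. apply RInt_ext. intros x _.
    replace (1 * x + 2 * PI) with (x + 2 * PI) by ring. rewrite Hp.
    unfold scal; simpl; unfold mult; simpl. ring. }
  pose proof (RInt_Chasles f c 0 (c + 2 * PI) (Ex _ _) (Ex _ _)) as E1.
  pose proof (RInt_Chasles f 0 (2 * PI) (c + 2 * PI) (Ex _ _) (Ex _ _)) as E2.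
  pose proof (opp_RInt_swap f 0 c (Ex _ _)) as E3.
  unfold plus, opp in *; simpl in *. lra.
Qed.

(** The substitution y = eta x removes the inverse map, and [rho] times [eta_x] becomes [nu]. The
    resulting integrand can be differentiated in a parameter of [eta]. *)
Lemma metric_lagrangian (nu lambda eta F : R -> R) (X : tangent) :
  volume_density nu -> circle_diffeo eta ->
  (forall r, 0 < r -> continuous lambda r) ->
  (forall x, continuous (fst X) x) -> (forall x, continuous (snd X) x) ->
  (forall x, fst X (x + 2 * PI) = fst X x) -> (forall x, snd X (x + 2 * PI) = snd X x) ->
  metric nu lambda (eta, F) X X =
  RInt (fun x => Derive eta x * lambda (nu x * / Derive eta x) * (snd X x * snd X x)
                 + nu x * (fst X x * fst X x)) 0 (2 * PI).
Proof.
  intros [[Hnu Pnu] nu_pos] Heta Hl C1 C2 P1 P2.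
  apply smooth_on_smooth in Hnu; auto.
  apply circle_diffeo_elim in Heta. destruct Heta as (Se & Pe & De).
  set (g := fun x => lambda (nu x / Derive eta x) * snd X x * snd X x
                 + nu x / Derive eta x * fst X x * fst X x).
  change (RInt (fun y => g (inv eta y)) 0 (2 * PI) = RInt
     (fun x => Derive eta x * lambda (nu x * / Derive eta x) * (snd X x * snd X x)
                 + nu x * (fst X x * fst X x)) 0 (2 * PI)).
  assert (CD : forall x, continuous (Derive eta) x).
  { intros x. exact (smooth_continuous everywhere _ x (smooth_Derive _ Se) I). }
  assert (Cr : forall x, continuous (fun x => nu x / Derive eta x) x).
  { intros x. apply (continuous_mult (K := R_AbsRing) nu (fun x => / Derive eta x)).
    - exact (smooth_continuous everywhere _ x Hnu I).
    - apply continuous_Rinv_comp; auto. specialize (De x); lra. }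
  assert (Cg : forall x, continuous g x).
  { intros x. apply (continuous_plus (V := R_NormedModule)
       (fun x => lambda (nu x / Derive eta x) * snd X x * snd X x)
       (fun x => nu x / Derive eta x * fst X x * fst X x)).
    - apply (continuous_mult (K := R_AbsRing)
       (fun x => lambda (nu x / Derive eta x) * snd X x) (snd X)); auto.
      apply (continuous_mult (K := R_AbsRing)
       (fun x => lambda (nu x / Derive eta x)) (snd X)); auto.
      apply (continuous_comp (fun x => nu x / Derive eta x) lambda); auto.
      apply Hl, Rdiv_lt_0_compat; auto.
    - apply (continuous_mult (K := R_AbsRing)
       (fun x => nu x / Derive eta x * fst X x) (fst X)); auto.
      apply (continuous_mult (K := R_AbsRing)
       (fun x => nu x / Derive eta x) (fst X)); auto. }
  assert (Cf : forall y, continuous (fun y => g (inv eta y)) y).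
  { intros y. apply continuous_comp; auto. apply continuous_inv_lift; auto. }
  assert (Pg : forall x, g (x + 2 * PI) = g x).
  { intros x. unfold g. rewrite P1, P2, Pnu, (Derive_period eta (2 * PI)); auto. }
  (* The substitution maps [0, 2 PI] onto the period starting at [eta 0], so the domain is first
     shifted there. *)
  rewrite <- (RInt_periodic (fun y => g (inv eta y)) (eta 0)); auto.
  2:{ intros y. rewrite inv_lift_period; auto. }
  rewrite <- Pe, Rplus_0_l.
  rewrite <- (RInt_comp (V := R_CompleteNormedModule) (fun y => g (inv eta y)) eta (Derive eta)); auto.
  - apply RInt_ext. intros x _. rewrite inv_lift; auto. unfold g, scal; simpl; unfold mult; simpl.
    unfold Rdiv. specialize (De x). field. lra.
  - intros x _. split; auto. apply smooth_is_derive; auto.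
Qed.

(** * The Euler-Lagrange equation of a barotropic geodesic *)

Notation dt := ((1, 0) : R * R).
Notation dx := ((0, 1) : R * R).

Notation ds := ((1, 0, 0) : R * R * R).

Ltac smoothness := repeat first
  [ assumption
  | apply smooth_plus | apply smooth_minus | apply smooth_mult | apply smooth_opp
  | apply smooth_const | apply smooth_D ].

Lemma triple_eq (x y z x' y' z' : R) : x = x' -> y = y' -> z = z' -> (x, y, z) = (x', y', z').
Proof. intros; subst; reflexivity. Qed.

Lemma D_dt (f : R * R -> R) (t x : R) : D dt f (t, x) = Derive (fun t => f (t, x)) t.
Proof.
  symmetry. apply (Derive_path f (fun t => (t, x))). intros r.
  change ((t + r, x) = (t + r * 1, x + r * 0)). f_equal; ring.
Qed.

Lemma D_dx (f : R * R -> R) (t x : R) : D dx f (t, x) = Derive (fun x => f (t, x)) x.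
Proof.
  symmetry. apply (Derive_path f (fun x => (t, x))). intros r.
  change ((t, x + r) = (t + r * 0, x + r * 1)). f_equal; ring.
Qed.

Lemma is_derive_dt (U : R * R -> Prop) (f : R * R -> R) (t x : R) :
  smooth U f -> U (t, x) -> is_derive (fun t => f (t, x)) t (D dt f (t, x)).
Proof.
  intros Hf HU. apply (is_derive_path U f (fun t => (t, x))); auto. intros r.
  change ((t + r, x) = (t + r * 1, x + r * 0)). f_equal; ring.
Qed.

Lemma is_derive_dx (U : R * R -> Prop) (f : R * R -> R) (t x : R) :
  smooth U f -> U (t, x) -> is_derive (fun x => f (t, x)) x (D dx f (t, x)).
Proof.
  intros Hf HU. apply (is_derive_path U f (fun x => (t, x))); auto. intros r.
  change ((t, x + r) = (t + r * 0, x + r * 1)). f_equal; ring.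
Qed.

(** The additive constant covers periodic functions (k = 0) and lifts of circle maps (k = 2 PI) at
    once. *)
Lemma D_shift {V : NormedModule R_AbsRing} (W : V -> Prop) (f : V -> R) (h w : V) (k : R) (p : V) :
  open W -> W p -> (forall q, W q -> f (plus q w) = f q + k) ->
  D h f (plus p w) = D h f p.
Proof.
  intros HW Hp Hf.
  transitivity (Derive (fun r : R => f (plus p (scal r h)) + k) 0).
  - apply Derive_ext_loc.
    refine (filter_imp _ _ _ (locally_line W p h (HW _ Hp))).
    intros r Hr. rewrite <- Hf; auto. f_equal.
    rewrite <- !plus_assoc. f_equal. apply plus_comm.
  - unfold D, Derive. f_equal. apply Lim_ext. intros y. f_equal. ring.
Qed.

Lemma D_period (W : R * R -> Prop) (f : R * R -> R) (h : R * R) (k t x : R) :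
  open W -> W (t, x) ->
  (forall t x, W (t, x) -> f (t, x + 2 * PI) = f (t, x) + k) ->
  D h f (t, x + 2 * PI) = D h f (t, x).
Proof.
  intros HW Hp Hf.
  assert (E : forall t x : R, plus (t, x) (0, 2 * PI) = (t, x + 2 * PI)).
  { intros t' x'. change ((t' + 0, x' + 2 * PI) = (t', x' + 2 * PI)). now rewrite Rplus_0_r. }
  rewrite <- E. apply (D_shift W f h (0, 2 * PI) k); auto.
  intros [t' x'] Hq. transitivity (f (t', x' + 2 * PI)); [apply f_equal, E|auto].
Qed.

Lemma RInt_zero_at (f : R -> R) (a b x : R) :
  (forall x, continuous f x) -> (forall x, 0 <= f x) -> a < x < b ->
  RInt f a b <= 0 -> f x = 0.
Proof.
  intros Hc Hf Hx Hi. destruct (Hf x) as [Hpos|]; auto. exfalso.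
  assert (Ex : forall a b, ex_RInt f a b).
  { intros; apply (ex_RInt_continuous (V := R_CompleteNormedModule)); auto. }
  destruct (Hc x (fun y => 0 < y) (open_gt 0 (f x) Hpos)) as [d Hd].
  pose proof (cond_pos d).
  set (m := Rmin (d / 2) (Rmin (x - a) (b - x))).
  assert (0 < m) by (repeat apply Rmin_glb_lt; lra).
  assert (m <= d / 2) by apply Rmin_l.
  assert (m <= x - a) by (eapply Rle_trans; [apply Rmin_r|apply Rmin_l]).
  assert (m <= b - x) by (eapply Rle_trans; [apply Rmin_r|apply Rmin_r]).
  pose proof (RInt_Chasles f a (x - m) b (Ex _ _) (Ex _ _)) as E1.
  pose proof (RInt_Chasles f (x - m) (x + m) b (Ex _ _) (Ex _ _)) as E2.
  unfold plus in *; simpl in *.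
  assert (0 <= RInt f a (x - m)) by (apply RInt_ge_0; auto; lra).
  assert (0 <= RInt f (x + m) b) by (apply RInt_ge_0; auto; lra).
  assert (0 < RInt f (x - m) (x + m)).
  { apply RInt_gt_0; auto; [lra|]. intros y Hy. apply Hd.
    apply Rabs_def1; unfold minus, plus, opp; simpl; lra. }
  lra.
Qed.

Lemma continuous_forget (p : R * R * R) :
  continuous (fun p : R * R * R => (snd (fst p), snd p)) p.
Proof.
  apply (continuous_comp_2 (fun p : R * R * R => snd (fst p)) snd pair).
  - apply (continuous_comp fst snd); [apply continuous_fst|apply continuous_snd].
  - apply continuous_snd.
  - apply continuous_ext with (fun z => z); [intros []; auto|apply continuous_id].
Qed.

Lemma smooth_forget (U : R * R -> Prop) (f : R * R -> R) :
  smooth U f ->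
  smooth (fun p : R * R * R => U (snd (fst p), snd p)) (fun p => f (snd (fst p), snd p)).
Proof.
  intros Hf. apply (smooth_affine (fun p : R * R * R => (snd (fst p), snd p))
    (fun p : R * R * R => (snd (fst p), snd p))); auto.
  apply continuous_forget.
Qed.

Lemma open_forget (U : R * R -> Prop) :
  open U -> open (fun p : R * R * R => U (snd (fst p), snd p)).
Proof.
  intros HU. apply (open_comp (fun p : R * R * R => (snd (fst p), snd p)) U); auto.
  intros p _. apply continuous_forget.
Qed.

Section EulerLagrange.
Variables (nu lambda : R -> R) (T : R) (c : R -> point).
Hypothesis Hnu : volume_density nu.
Hypothesis Hlambda_smooth : smooth_on (fun r : R => 0 < r) lambda.
Hypothesis Hlambda_pos : forall r, 0 < r -> 0 < lambda r.
Hypothesis Hpressure : forall r, 0 < r -> pressure lambda r = r ^ 3 / 3.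
Hypothesis Hc : barotropic_geodesic nu lambda T c.

Let e (p : R * R) : R := fst (c (fst p)) (snd p).
Let F (p : R * R) : R := snd (c (fst p)) (snd p).
(** Open in time, so that periodicity and the sign of the x-derivative of [e] hold on a full
    neighbourhood of each point, as differentiation requires. *)
Let W (p : R * R) : Prop := 0 < fst p < T.

Lemma open_W : open W.
Proof.
  apply open_and.
  - apply (open_comp fst (fun t => 0 < t)); [intros; apply continuous_fst|apply open_gt].
  - apply (open_comp fst (fun t => t < T)); [intros; apply continuous_fst|apply open_lt].
Qed.

Lemma smooth_e : smooth W e.
Proof.
  destruct Hc as [[[(U & _ & HU & H) _] _] _]. apply smooth_subset with U; auto.
  intros p [H1 H2]. apply HU. lra.
Qed.

Lemma smooth_F : smooth W F.
Proof.
  destruct Hc as [[[_ (U & _ & HU & H)] _] _]. apply smooth_subset with U; auto.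
  intros p [H1 H2]. apply HU. lra.
Qed.

Lemma W_diffeo t : 0 < t < T -> circle_diffeo (fst (c t)).
Proof. intros Ht. apply Hc. lra. Qed.

Lemma e_period (t x : R) : W (t, x) -> e (t, x + 2 * PI) = e (t, x) + 2 * PI.
Proof. intros Ht. apply (circle_diffeo_elim _ (W_diffeo t Ht)). Qed.

Lemma F_period (t x : R) : W (t, x) -> F (t, x + 2 * PI) = F (t, x) + 0.
Proof.
  intros [Ht1 Ht2]. rewrite Rplus_0_r. destruct Hc as [[_ [H _]] _].
  simpl in *. apply (H t); lra.
Qed.

Lemma e_x_pos p : W p -> 0 < D dx e p.
Proof.
  destruct p as [t x]. intros Hp. rewrite D_dx. apply (circle_diffeo_elim _ (W_diffeo t Hp)).
Qed.

Lemma smooth_nu : smooth everywhere nu.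
Proof. destruct Hnu as [[H _] _]. apply smooth_on_smooth with (2 := H). auto. Qed.

Lemma smooth_nu_snd : smooth W (fun p => nu (snd p)).
Proof.
  apply smooth_subset with (fun p : R * R => everywhere (snd p)); [intros; exact I|].
  apply (smooth_snd everywhere), smooth_nu.
Qed.

Let r (p : R * R) : R := nu (snd p) * / D dx e p.

Lemma smooth_lagrangian_density : smooth W r.
Proof.
  apply smooth_mult; auto using open_W, smooth_nu_snd.
  apply smooth_inv; auto using open_W, smooth_D, smooth_e.
  intros p Hp. apply Rgt_not_eq, e_x_pos; auto.
Qed.

Lemma F_t (t x : R) : W (t, x) -> D dt F (t, x) = r (t, x) / lambda (r (t, x)).
Proof.
  intros Ht. rewrite D_dt. destruct Hc as [_ H].
  specialize (H t x ltac:(unfold W in Ht; simpl in Ht; lra)).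
  unfold velocity in H; simpl in H. unfold F; simpl.
  destruct (circle_diffeo_elim _ (W_diffeo t Ht)) as (H1 & H2 & H3).
  assert (E : density nu (fst (c t)) (fst (c t) x) = r (t, x)).
  { unfold density, r. rewrite inv_lift; auto. rewrite D_dx. reflexivity. }
  rewrite E in H. exact H.
Qed.

(** [P] is the pressure in Lagrangian variables, and [Q = 0] is Newton's law: mass density times
    acceleration balances the pressure gradient. *)
Let P (p : R * R) : R := / 3 * (r p * r p * r p).
Let Q (p : R * R) : R := nu (snd p) * D dt (D dt e) p + D dx P p.

Lemma smooth_P : smooth W P.
Proof. pose proof open_W. pose proof smooth_lagrangian_density. unfold P. smoothness. Qed.

Lemma smooth_Q : smooth W Q.
Proof.
  pose proof open_W. pose proof smooth_P. pose proof smooth_e. pose proof smooth_nu_snd.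
  unfold Q. smoothness.
Qed.

Lemma D_e_period h (t x : R) : W (t, x) -> D h e (t, x + 2 * PI) = D h e (t, x).
Proof. intros Ht. apply D_period with W (2 * PI); auto using open_W, e_period. Qed.

Lemma nu_period x : nu (x + 2 * PI) = nu x.
Proof. apply Hnu. Qed.

Lemma P_period (t x : R) : W (t, x) -> P (t, x + 2 * PI) = P (t, x).
Proof. intros Ht. unfold P, r; simpl. rewrite nu_period, D_e_period; auto. Qed.

Lemma Q_period (t x : R) : W (t, x) -> Q (t, x + 2 * PI) = Q (t, x).
Proof.
  intros Ht. unfold Q; simpl. rewrite nu_period.
  rewrite (D_period W P dx 0), (D_period W (D dt e) dt 0); auto using open_W.
  - intros; rewrite Rplus_0_r; apply D_e_period; auto.
  - intros; rewrite Rplus_0_r; apply P_period; auto.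
Qed.


(** * First variation of the energy *)

Section Variation.
Variables (a b : R) (g : R -> R).
Hypotheses (a_pos : 0 < a) (a_lt_b : a < b) (b_lt_T : b < T).
Hypothesis g_smooth : smooth everywhere g.
Hypothesis g_period : forall x, g (x + 2 * PI) = g x.

(** Fixed end points only require vanishing at a and b, so a polynomial that is positive in between
    is enough. *)
Let chi (t : R) : R := (t - a) * (b - t).
(** The bounds [a'] and [b'] enlarge [a, b] inside (0, T), which provides an open set around the
    compact time interval. *)
Let a' : R := a / 2.
Let b' : R := (b + T) / 2.

Lemma smooth_chi : smooth everywhere chi.
Proof.
  pose proof (@open_everywhere R_UniformSpace). pose proof smooth_id.
  unfold chi. smoothness.
Qed.

(** Factoring out [D dx e], the sum is positive once [s] times the ratio [chi * g' / e_x] stays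
    below 1 in absolute value. The ratio is bounded on a rectangle of one period, and periodicity
    extends the result to all x. *)
Lemma step_size : exists d, 0 < d /\ forall s t x : R, Rabs s < d -> a' < t < b' ->
  0 < D dx e (t, x) + s * (chi t * Derive g x).
Proof.
  pose proof PI_RGT_0.
  assert (HW : forall t x, a' <= t <= b' -> W (t, x)).
  { intros t x Ht. unfold W, a', b' in *; simpl. lra. }
  destruct (bounded_rectangle (fun t x => chi t * Derive g x * / D dx e (t, x)) a' b' 0 (2 * PI))
    as [K HK].
  { intros t x Ht _.
    apply (continuous_mult (K := R_AbsRing) (fun z : R * R => chi (fst z) * Derive g (snd z))
       (fun z : R * R => / D dx e (fst z, snd z))).
    - apply (continuous_mult (K := R_AbsRing) (fun z : R * R => chi (fst z))
        (fun z : R * R => Derive g (snd z))).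
      + apply (continuous_comp fst chi); [apply continuous_fst|].
        exact (smooth_continuous everywhere _ t smooth_chi I).
      + apply (continuous_comp snd (Derive g)); [apply continuous_snd|].
        exact (smooth_continuous everywhere _ x (smooth_Derive _ g_smooth) I).
    - apply continuous_ext with (fun z : R * R => / D dx e z); [intros []; auto|].
      apply (smooth_continuous W); [|apply HW; auto].
      apply smooth_inv; auto using open_W, smooth_D, smooth_e.
      intros p Hp. apply Rgt_not_eq, e_x_pos; auto. }
  assert (K0 : 0 <= K).
  { apply Rle_trans with (2 := HK a' 0 ltac:(unfold a', b'; lra) ltac:(lra)). apply Rabs_pos. }
  (* K may be 0, hence K + 1. *)
  exists (/ (K + 1)). split; [apply Rinv_0_lt_compat; lra|].
  intros s t x Hs Ht. revert x.
  assert (Pd : forall x, Derive g (x + 2 * PI) = Derive g x).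
  { apply (Derive_period g 0). intros; rewrite g_period; ring. }
  apply periodic_extend.
  - intros x Hx. rewrite Pd, D_e_period; auto. apply HW; lra.
  - intros x Hx. rewrite <- Pd, <- D_e_period; [|apply HW; lra].
    replace (x - 2 * PI + 2 * PI) with x by ring. auto.
  - intros x Hx. specialize (HK t x ltac:(lra) Hx).
    assert (Hq : 0 < D dx e (t, x)) by (apply e_x_pos, HW; lra).
    set (q := D dx e (t, x)) in *. set (y := chi t * Derive g x) in *.
    change (0 < q + s * y). replace (q + s * y) with (q * (1 + s * (y * / q))) by (field; lra).
    apply Rmult_lt_0_compat; auto.
    assert (Rabs (s * (y * / q)) < 1).
    { rewrite Rabs_mult. apply Rle_lt_trans with (Rabs s * K).
      - apply Rmult_le_compat_l; auto. apply Rabs_pos.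
      - pose proof (Rabs_pos s).
        assert (Rabs s * (K + 1) < 1).
        { apply Rmult_lt_reg_r with (/ (K + 1)); [apply Rinv_0_lt_compat; lra|].
          replace (Rabs s * (K + 1) * / (K + 1)) with (Rabs s) by (field; lra). lra. }
        nra. }
    match goal with G : Rabs _ < 1 |- _ => apply Rabs_def2 in G end. lra.
Qed.

Let W3 (p : R * R * R) : Prop := W (snd (fst p), snd p).

Lemma open_W3 : open W3.
Proof. apply open_forget, open_W. Qed.

Lemma smooth_time3 f : smooth everywhere f -> smooth W3 (fun p => f (snd (fst p))).
Proof.
  intros Hf. apply smooth_subset with (fun p : R * R * R => everywhere (snd (fst p))).
  - intros; exact I.
  - exact (smooth_fst _ _ (smooth_snd everywhere f Hf)).
Qed.

Lemma smooth_space3 f : smooth everywhere f -> smooth W3 (fun p => f (snd p)).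
Proof.
  intros Hf. apply smooth_subset with (fun p : R * R * R => everywhere (snd p)).
  - intros; exact I.
  - exact (smooth_snd everywhere f Hf).
Qed.

Lemma smooth_s3 : smooth W3 (fun p => fst (fst p)).
Proof.
  apply smooth_subset with (fun p : R * R * R => everywhere (fst (fst p))).
  - intros; exact I.
  - exact (smooth_fst _ _ (smooth_fst _ _ smooth_id)).
Qed.

(** Only the position on the circle is moved; the second component enters the result through the
    barotropic relation [F_t]. *)
Let H (s t : R) : point :=
  (fun x => e (t, x) + s * (chi t * g x), snd (c t)).

Lemma variation_proper d :
  0 < d ->
  (forall s t x : R, Rabs s < d -> a' < t < b' -> 0 < D dx e (t, x) + s * (chi t * Derive g x)) ->
  proper_variation a b d c H.
Proof.
  intros Hd Hpos.
  destruct Hc as [[_ [Hconf _]] _].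
  assert (HA : forall p : R * R * R, Rabs (fst (fst p)) < d /\ a <= snd (fst p) <= b -> W3 p).
  { intros p [_ Hp]; unfold W3, W; simpl; lra. }
  split; [split|split; [|split]].
  - exists W3. split; [apply open_W3|split; auto].
    pose proof open_W3. pose proof (smooth_time3 _ smooth_chi). pose proof (smooth_space3 _ g_smooth).
    pose proof smooth_s3. pose proof (smooth_forget W e smooth_e).
    change (smooth W3 (fun p : R * R * R =>
      e (snd (fst p), snd p) + fst (fst p) * (chi (snd (fst p)) * g (snd p)))).
    smoothness.
  - exists W3. split; [apply open_W3|split; auto].
    exact (smooth_forget W F smooth_F).
  - intros s t Hs Ht. split; [|apply Hconf; lra].
    assert (Wt : forall x, W (t, x)) by (intros; unfold W; simpl; lra).
    assert (Se : smooth everywhere (fun x => e (t, x))).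
    { apply smooth_subset with (fun x => W (t, x)); auto. apply smooth_section, smooth_e. }
    assert (E : forall x, is_derive (fun x => e (t, x) + s * (chi t * g x)) x
                     (D dx e (t, x) + s * (chi t * Derive g x))).
    { intros x. apply (is_derive_plus (V := R_NormedModule) (fun x => e (t, x))).
      - apply is_derive_dx with W; auto using smooth_e.
      - apply is_derive_scal, is_derive_scal, smooth_is_derive, g_smooth. }
    apply circle_diffeo_intro.
    + pose proof (@open_everywhere R_UniformSpace). simpl. smoothness.
    + intros x. simpl. rewrite g_period, e_period; auto. ring.
    + intros x. replace (Derive (fst (H s t)) x) with (D dx e (t, x) + s * (chi t * Derive g x)).
      * apply Hpos; auto. unfold a', b'; lra.
      * symmetry. apply is_derive_unique, E.
  - intros t Ht x. simpl. split; auto. unfold e; simpl; ring.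
  - intros s Hs. split; intros x; simpl; (split; auto); unfold e, chi; simpl; ring.
Qed.

Section Energy.
Variable d : R.
Hypothesis d_pos : 0 < d.
Hypothesis step : forall s t x : R, Rabs s < d -> a' < t < b' ->
  0 < D dx e (t, x) + s * (chi t * Derive g x).

Let O3 (p : R * R * R) : Prop := Rabs (fst (fst p)) < d /\ a' < snd (fst p) < b'.
Let q3 (p : R * R * R) : R :=
  D dx e (snd (fst p), snd p) + fst (fst p) * (chi (snd (fst p)) * Derive g (snd p)).
Let w3 (p : R * R * R) : R :=
  D dt e (snd (fst p), snd p) + fst (fst p) * (Derive chi (snd (fst p)) * g (snd p)).
Let f3 (p : R * R * R) : R := D dt F (snd (fst p), snd p).
(** The energy density in Lagrangian form: [q3] and [w3] are the x- and t-derivatives of the varied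
    map, [f3] is the time derivative of [F]. *)
Let Lag (p : R * R * R) : R :=
  / 2 * (q3 p * lambda (nu (snd p) * / q3 p) * (f3 p * f3 p) + nu (snd p) * (w3 p * w3 p)).

Lemma open_O3 : open O3.
Proof.
  apply open_and; [|apply open_and].
  - apply (open_comp (fun p : R * R * R => Rabs (fst (fst p))) (fun y => y < d)); [|apply open_lt].
    intros p _. apply (continuous_comp (fun p : R * R * R => fst (fst p)) Rabs).
    + apply (continuous_comp fst fst); apply continuous_fst.
    + apply continuous_Rabs.
  - apply (open_comp (fun p : R * R * R => snd (fst p)) (fun y => a' < y)); [|apply open_gt].
    intros p _. apply (continuous_comp fst snd); [apply continuous_fst|apply continuous_snd].
  - apply (open_comp (fun p : R * R * R => snd (fst p)) (fun y => y < b')); [|apply open_lt].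
    intros p _. apply (continuous_comp fst snd); [apply continuous_fst|apply continuous_snd].
Qed.

Lemma O3_W3 p : O3 p -> W3 p.
Proof. intros [_ Hp]. unfold W3, W, a', b' in *; simpl. lra. Qed.

Lemma q3_pos p : O3 p -> 0 < q3 p.
Proof. intros [H1 H2]. apply step; auto. Qed.

Lemma volume_pos x : 0 < nu x.
Proof. apply Hnu. Qed.

Lemma smooth_O3 f : smooth W3 f -> smooth O3 f.
Proof. intros Hf. apply smooth_subset with W3; auto. apply O3_W3. Qed.

Lemma smooth_q3 : smooth O3 q3.
Proof.
  pose proof open_O3.
  pose proof (smooth_O3 _ (smooth_time3 _ smooth_chi)).
  pose proof (smooth_O3 _ (smooth_space3 _ (smooth_Derive _ g_smooth))).
  pose proof (smooth_O3 _ smooth_s3).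
  pose proof (smooth_O3 _ (smooth_forget W _ (smooth_D _ _ dx smooth_e))).
  unfold q3. smoothness.
Qed.

Lemma smooth_w3 : smooth O3 w3.
Proof.
  pose proof open_O3.
  pose proof (smooth_O3 _ (smooth_time3 _ (smooth_Derive _ smooth_chi))).
  pose proof (smooth_O3 _ (smooth_space3 _ g_smooth)).
  pose proof (smooth_O3 _ smooth_s3).
  pose proof (smooth_O3 _ (smooth_forget W _ (smooth_D _ _ dt smooth_e))).
  unfold w3. smoothness.
Qed.

Lemma smooth_f3 : smooth O3 f3.
Proof. exact (smooth_O3 _ (smooth_forget W _ (smooth_D _ _ dt smooth_F))). Qed.

Lemma smooth_Lag : smooth O3 Lag.
Proof.
  pose proof open_O3. pose proof smooth_q3. pose proof smooth_w3. pose proof smooth_f3.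
  pose proof (smooth_O3 _ (smooth_space3 _ smooth_nu)).
  assert (Sqi : smooth O3 (fun p => / q3 p)).
  { apply smooth_inv; auto. intros p Hp. apply Rgt_not_eq, q3_pos; auto. }
  assert (Sl : smooth O3 (fun p => lambda (nu (snd p) * / q3 p))).
  { destruct Hlambda_smooth as (U & _ & HU & HS).
    apply (smooth_comp O3 U (fun p => nu (snd p) * / q3 p) lambda); auto.
    - intros p Hp. apply HU. apply Rmult_lt_0_compat; [apply volume_pos|].
      apply Rinv_0_lt_compat, q3_pos; auto.
    - smoothness. }
  unfold Lag. smoothness.
Qed.

Lemma energy_variation s : Rabs s < d ->
  energy nu lambda a b (H s) = RInt (fun t => RInt (fun x => Lag ((s, t), x)) 0 (2 * PI)) a b.
Proof.
  intros Hs. pose proof PI_RGT_0.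
  destruct (variation_proper d d_pos step) as (_ & Hconf & _).
  unfold energy. apply RInt_ext. rewrite Rmin_left, Rmax_right by lra. intros t Ht.
  assert (Wt : forall x, W (t, x)) by (intros; unfold W; simpl; lra).
  assert (Ev : velocity (H s) t = (fun x => w3 ((s, t), x), fun x => f3 ((s, t), x))).
  { unfold velocity, w3, f3. simpl. f_equal; apply functional_extensionality; intros x.
    - apply is_derive_unique.
      apply (is_derive_plus (V := R_NormedModule) (fun t => e (t, x))).
      + apply is_derive_dt with W; auto using smooth_e.
      + apply is_derive_scal. apply (is_derive_scal_l (V := R_NormedModule)).
        apply smooth_is_derive, smooth_chi.
    - symmetry. apply D_dt. }
  assert (Sl : smooth (fun x => O3 ((s, t), x)) (fun x => Lag ((s, t), x))).
  { apply smooth_section, smooth_Lag. }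
  assert (Ot : forall x, O3 ((s, t), x)) by (intros x; split; simpl; unfold a', b'; lra).
  rewrite Ev. unfold H. rewrite metric_lagrangian; auto.
  - rewrite (RInt_ext _ (fun x => scal 2 (Lag ((s, t), x)))).
    + rewrite (RInt_scal (V := R_CompleteNormedModule)).
      * unfold scal; simpl; unfold mult; simpl. field.
      * apply (ex_RInt_continuous (V := R_CompleteNormedModule)). intros x _.
        exact (smooth_continuous _ _ x Sl (Ot x)).
    + intros x _. cbn [fst snd].
      replace (Derive (fun x => e (t, x) + s * (chi t * g x)) x) with (q3 ((s, t), x)).
      * change (q3 (s, t, x) * lambda (nu x * / q3 (s, t, x)) * (f3 (s, t, x) * f3 (s, t, x)) +
          nu x * (w3 (s, t, x) * w3 (s, t, x)) = 2 * Lag (s, t, x)).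
        unfold Lag. cbn [fst snd]. field.
      * symmetry. apply is_derive_unique.
        apply (is_derive_plus (V := R_NormedModule) (fun x => e (t, x))).
        -- apply is_derive_dx with W; auto using smooth_e.
        -- apply is_derive_scal, is_derive_scal, smooth_is_derive, g_smooth.
  - apply (Hconf s t); lra.
  - intros x Hx. destruct Hlambda_smooth as (U & _ & HU & HS).
    apply (smooth_continuous U); auto.
  - intros x. exact (smooth_continuous _ _ x (smooth_section _ _ _ smooth_w3) (Ot x)).
  - intros x. exact (smooth_continuous _ _ x (smooth_section _ _ _ smooth_f3) (Ot x)).
  - intros x. unfold w3; simpl. rewrite g_period, D_e_period; auto.
  - intros x. unfold f3; simpl. apply D_period with W 0; auto using open_W, F_period.
Qed.

(** The derivative in s passes through both integrals: the inner one is smooth in (s, t), and the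
    outer one is then differentiated under the sign. Criticality of the geodesic makes the result
    0. *)
Lemma first_variation :
  RInt (fun t => RInt (fun x => D ds Lag ((0, t), x)) 0 (2 * PI)) a b = 0.
Proof.
  pose proof PI_RGT_0 as Hpi. assert (Hpi' : 0 <= 2 * PI) by lra.
  set (F1 := fun p : R * R => RInt (fun x => Lag (p, x)) 0 (2 * PI)).
  set (O2 := fun p : R * R => forall x, 0 <= x <= 2 * PI -> O3 (p, x)).
  assert (OO2 : open O2) by exact (open_below O3 0 (2 * PI) open_O3).
  assert (S1 : smooth O2 F1) by exact (smooth_RInt O3 0 (2 * PI) open_O3 Hpi' Lag smooth_Lag).
  assert (HO2 : forall t, a <= t <= b -> O2 (0, t)).
  { intros t Ht x _. split; simpl; [rewrite Rabs_R0|unfold a', b']; lra. }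
  pose proof (is_derive_RInt_section O2 a b OO2 (Rlt_le _ _ a_lt_b) F1 (1 : R) (0 : R) S1 HO2) as E.
  destruct Hc as [[_ [_ Hgeo]] _].
  specialize (Hgeo a b d H (Rlt_le _ _ a_pos) a_lt_b b_lt_T d_pos (variation_proper d d_pos step)).
  transitivity (RInt (fun t => D ((1 : R), zero) F1 (0, t)) a b).
  - apply RInt_ext. rewrite Rmin_left, Rmax_right by lra. intros t Ht.
    symmetry. apply (D_RInt O3 0 (2 * PI) open_O3 Hpi' Lag (1, zero) (0, t)).
    + apply smooth_Lag.
    + apply HO2; lra.
  - refine (eq_trans (eq_sym (is_derive_unique _ _ _ E)) _). apply is_derive_unique.
    apply is_derive_ext_loc with (2 := Hgeo).
    exists (mkposreal d d_pos). intros s Hs. rewrite energy_variation.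
    + assert (Es : plus (0 : R) (scal s (1 : R)) = s).
      { change (0 + s * 1 = s). ring. }
      exact (f_equal (fun z : R => RInt (fun t => F1 (z, t)) a b) (eq_sym Es)).
    + change (Rabs (s + - 0) < d) in Hs. rewrite Ropp_0, Rplus_0_r in Hs. exact Hs.
Qed.

(** The derivative of q * lambda (nu / q) in q is lambda - rho * lambda', that is 2 phi at rho = nu
    / q. Multiplied by f^2 / 2 with f = rho / lambda it becomes [pressure], hence [P]. The kinetic
    term gives the summand with the derivative of [chi]. *)
Lemma D_ds_Lag (t x : R) : a' < t < b' ->
  D ds Lag ((0, t), x) =
  chi t * (P (t, x) * Derive g x) + Derive chi t * (nu x * D dt e (t, x) * g x).
Proof.
  intros Ht. assert (Wt : W (t, x)) by (unfold W, a', b' in *; simpl; lra).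
  pose proof (e_x_pos _ Wt) as Hq. pose proof (volume_pos x) as Hn.
  assert (Hr : 0 < r (t, x)) by (apply Rmult_lt_0_compat; [|apply Rinv_0_lt_compat]; auto).
  pose proof (Hlambda_pos _ Hr) as Hl. pose proof (Hpressure _ Hr) as Hp.
  pose proof (F_t t x Wt) as HF.
  assert (El : ex_derive lambda (r (t, x))).
  { destruct Hlambda_smooth as (U & _ & HU & HS).
    apply (ex_derive_ext (fun z => lambda z)); auto.
    eexists. apply (is_derive_path U lambda (fun z => z) 1 (r (t, x)) HS (HU _ Hr)).
    intros z. unfold plus, scal; simpl; unfold mult; simpl. ring. }
  rewrite <- (Derive_path Lag (fun s => ((s, t), x)) ds 0).
  2:{ intros s. change ((0 + s, t, x) = (0 + s * 1, t + s * 0, x + s * 0)).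
      apply triple_eq; ring. }
  apply is_derive_unique. unfold Lag, q3, w3, f3; cbn [fst snd]. rewrite HF.
  unfold P, pressure, phi in *.
  assert (Er : r (t, x) = nu x * / D dx e (t, x)) by reflexivity.
  set (q := D dx e (t, x)) in *. set (w := D dt e (t, x)).
  set (A := chi t * Derive g x). set (B := Derive chi t * g x).
  set (rr := r (t, x)) in *.
  auto_derive.
  - rewrite Rmult_0_l, Rplus_0_r. rewrite <- Er. split; [exact El|]. split; auto. apply Rgt_not_eq, Hq.
  - rewrite !Rmult_0_l, !Rplus_0_r. rewrite <- Er.
    change (fun x0 : R => lambda x0) with lambda.
    set (l := lambda rr) in *. set (l' := Derive lambda rr) in *.
    (* The pressure law solved for the derivative of [lambda]: lambda - rho * lambda' = 2 lambda^2
       rho / 3. *)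
    assert (Hl' : l' = (l - 2 * (l * l) * rr / 3) / rr).
    { assert (Hl0 : l <> 0) by lra. assert (Hr0 : rr <> 0) by lra.
      assert (E : l - rr * l' = rr ^ 2 * (/ 2 * (l - rr * l')) / l ^ 2 * (2 * l ^ 2 / rr ^ 2))
        by (field; auto).
      rewrite Hp in E. apply Rmult_eq_reg_l with rr; auto.
      replace (rr * l') with (l - rr ^ 3 / 3 * (2 * l ^ 2 / rr ^ 2)) by lra. field; auto. }
    replace (nu x) with (rr * q) by (rewrite Er; field; lra).
    rewrite Hl'. unfold A, B. field. lra.
Qed.

Lemma W_below t : 0 < t < T -> forall x, 0 <= x <= 2 * PI -> W (t, x).
Proof. intros Ht x _. exact Ht. Qed.

Lemma smooth_space f : smooth everywhere f -> smooth W (fun p => f (snd p)).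
Proof.
  intros Hf. apply smooth_subset with (fun p : R * R => everywhere (snd p)).
  - intros; exact I.
  - apply smooth_snd, Hf.
Qed.

Lemma smooth_time f : smooth everywhere f -> smooth W (fun p => f (fst p)).
Proof.
  intros Hf. apply smooth_subset with (fun p : R * R => everywhere (fst p)).
  - intros; exact I.
  - apply smooth_fst, Hf.
Qed.

(** Integration by parts: in x there is no boundary term by periodicity, in t there is none because
    [chi] vanishes at a and b. *)
Lemma variation_Q : RInt (fun t => chi t * RInt (fun x => Q (t, x) * g x) 0 (2 * PI)) a b = 0.
Proof.
  pose proof PI_RGT_0 as Hpi. assert (Hpi' : 0 <= 2 * PI) by lra.
  pose proof first_variation as E.
  pose proof open_W as OW.
  pose proof (smooth_space _ g_smooth) as Sg. pose proof (smooth_space _ smooth_nu) as Sn.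
  pose proof (smooth_time _ smooth_chi) as Sc.
  pose proof smooth_P as SP. pose proof smooth_Q as SQ.
  assert (Set' : smooth W (D dt e)) by apply smooth_D, smooth_e.
  set (S := fun p : R * R => chi (fst p) * (nu (snd p) * D dt e p * g (snd p))).
  set (Y := fun p : R * R => P p * g (snd p)).
  set (Z := fun p : R * R => Q p * g (snd p)).
  assert (SS : smooth W S) by (unfold S; smoothness).
  assert (SY : smooth W Y) by (unfold Y; smoothness).
  assert (SZ : smooth W Z) by (unfold Z; smoothness).
  set (I := fun t => 0 < t < T).
  assert (OI : open I) by (apply open_and; [apply open_gt|apply open_lt]).
  assert (SI : forall f, smooth W f -> smooth I (fun t => RInt (fun x => f (t, x)) 0 (2 * PI))).
  { intros f Hf.
    apply smooth_subset with (fun t : R => forall x, 0 <= x <= 2 * PI -> W (t, x)).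
    - exact W_below.
    - exact (smooth_RInt W 0 (2 * PI) OW Hpi' f Hf). }
  assert (Dg : forall f h1 h2 t x, smooth everywhere f ->
     D (h1, h2) (fun p : R * R => f (snd p)) (t, x) = h2 * Derive f x).
  { intros f h1 h2 t x Hf.
    rewrite (D_affine (V := prod_NormedModule R_AbsRing R_NormedModule R_NormedModule)
     (W := R_NormedModule) snd snd) by auto. apply D_Derive; auto. }
  assert (Dt : forall f h1 h2 t x, smooth everywhere f ->
     D (h1, h2) (fun p : R * R => f (fst p)) (t, x) = h1 * Derive f t).
  { intros f h1 h2 t x Hf.
    rewrite (D_affine (V := prod_NormedModule R_AbsRing R_NormedModule R_NormedModule)
     (W := R_NormedModule) fst fst) by auto. apply D_Derive; auto. }
  set (BS := fun t => RInt (fun x => S (t, x)) 0 (2 * PI)).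
  (* The integrand is [chi] times the x-derivative of [Y], plus the t-derivative of [S], minus
     [chi * Z]; the first of these integrates to 0 over a period. *)
  assert (Inner : forall t, a < t < b -> RInt (fun x => D ds Lag ((0, t), x)) 0 (2 * PI) =
     D 1 BS t - chi t * RInt (fun x => Z (t, x)) 0 (2 * PI)).
  { intros t Ht.
    assert (Wt : forall x, W (t, x)) by (intros; unfold W; simpl; lra).
    assert (Ex : forall f, smooth W f -> ex_RInt (fun x => f (t, x)) 0 (2 * PI)).
    { intros f Hf. apply (ex_RInt_section W 0 (2 * PI) Hpi').
      - intros q Hq. apply (smooth_continuous W); auto.
      - intros x _; auto. }
    assert (EBS : D 1 BS t = RInt (fun x => D dt S (t, x)) 0 (2 * PI)).
    { apply (D_RInt W 0 (2 * PI) OW Hpi' S (1 : R) (t : R) SS). intros x _; auto. }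
    assert (EY : RInt (fun x => D dx Y (t, x)) 0 (2 * PI) = 0).
    { apply is_RInt_unique.
      replace 0 with (minus (Y (t, 2 * PI)) (Y (t, 0))) at 2.
      - apply (is_RInt_derive (V := R_CompleteNormedModule) (fun x => Y (t, x))).
        + intros x _. apply is_derive_dx with W; auto.
        + intros x _. apply (continuous_section (fun p => D dx Y p) t x).
          apply (smooth_continuous W); auto. apply smooth_D; auto.
      - unfold Y; simpl. rewrite <- (Rplus_0_l (2 * PI)), P_period, g_period; auto.
        apply Rplus_opp_r. }
    rewrite EBS.
    transitivity (RInt (fun x => plus (scal (chi t) (D dx Y (t, x)))
       (minus (D dt S (t, x)) (scal (chi t) (Z (t, x))))) 0 (2 * PI)).
    - apply RInt_ext. intros x _. rewrite D_ds_Lag; auto.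
      2:{ unfold a', b'; lra. }
      unfold plus, minus, opp, plus, scal; simpl; unfold mult; simpl.
      unfold Y, S. rewrite (D_mult W P), (D_mult W (fun p => chi (fst p))); auto;
        [|smoothness].
      rewrite (D_mult W (fun p => nu (snd p) * D dt e p)); auto; [|smoothness].
      rewrite (D_mult W (fun p => nu (snd p)) (D dt e)); auto.
      rewrite !Dg, Dt; auto using smooth_nu, smooth_chi. simpl.
      unfold Z, Q; simpl. ring.
    - rewrite (RInt_plus (V := R_CompleteNormedModule)).
      + rewrite (RInt_scal (V := R_CompleteNormedModule)) by (apply (Ex _ (smooth_D _ _ dx SY))).
        rewrite EY. rewrite (RInt_minus (V := R_CompleteNormedModule)).
        * rewrite (RInt_scal (V := R_CompleteNormedModule)) by (apply (Ex _ SZ)).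
          unfold plus, minus, opp, plus, scal; simpl; unfold mult; simpl. ring.
        * apply (Ex _ (smooth_D _ _ dt SS)).
        * apply (ex_RInt_scal (V := R_NormedModule)), (Ex _ SZ).
      + apply (ex_RInt_scal (V := R_NormedModule)), (Ex _ (smooth_D _ _ dx SY)).
      + apply (ex_RInt_minus (V := R_NormedModule)).
        * apply (Ex _ (smooth_D _ _ dt SS)).
        * apply (ex_RInt_scal (V := R_NormedModule)), (Ex _ SZ). }
  rewrite (RInt_ext _ (fun t => minus (D 1 BS t) (chi t * RInt (fun x => Z (t, x)) 0 (2 * PI))))
    in E.
  2:{ intros t. rewrite Rmin_left, Rmax_right by lra. apply Inner. }
  assert (SBS : smooth I BS) by exact (SI S SS).
  assert (HI : forall t, Rmin a b <= t <= Rmax a b -> I t).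
  { intros t. rewrite Rmin_left, Rmax_right by lra. unfold I; lra. }
  assert (SC : smooth I (fun t => chi t * RInt (fun x => Z (t, x)) 0 (2 * PI))).
  { apply smooth_mult; auto.
    apply smooth_subset with everywhere; [intros; exact Logic.I|apply smooth_chi]. }
  assert (EB : is_RInt (D 1 BS) a b (minus (BS b) (BS a))).
  { apply (is_RInt_derive (V := R_CompleteNormedModule)).
    - intros t Ht. apply (is_derive_path I BS (fun t => t)); auto.
      intros z. unfold plus, scal; simpl; unfold mult; simpl. ring.
    - intros t Ht. apply (smooth_continuous I); auto. apply smooth_D; auto. }
  assert (BS0 : forall t, chi t = 0 -> BS t = 0).
  { intros t Ht. unfold BS, S; simpl. rewrite Ht.
    rewrite (RInt_ext _ (fun _ => 0)) by (intros; apply Rmult_0_l).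
    rewrite RInt_const. unfold scal; simpl; unfold mult; simpl. ring. }
  rewrite (RInt_minus (V := R_CompleteNormedModule)) in E.
  - rewrite (is_RInt_unique _ _ _ _ EB) in E.
    rewrite (BS0 a), (BS0 b) in E by (unfold chi; ring).
    unfold minus, plus, opp in E; simpl in E. unfold Z in E; simpl in E. lra.
  - eexists; apply EB.
  - apply (ex_RInt_continuous (V := R_CompleteNormedModule)). intros t Ht.
    apply (smooth_continuous I); auto.
Qed.

End Energy.
End Variation.

(** With [g] the expression at time t0 itself, [C t0] is the integral of a square. If it were
    positive, [C] would be positive on a short interval around t0, and so would its integral against
    [chi], contradicting [variation_Q]. *)
Lemma euler_lagrange_expression_zero (t0 x0 : R) : 0 < t0 < T -> Q (t0, x0) = 0.
Proof.
  intros Ht0. pose proof PI_RGT_0 as Hpi. assert (Hpi' : 0 <= 2 * PI) by lra.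
  set (g := fun x => Q (t0, x)).
  assert (Sg : smooth everywhere g).
  { apply smooth_subset with (fun x => W (t0, x)); [intros; exact Ht0|].
    apply (smooth_section W Q t0), smooth_Q. }
  assert (Pg : forall x, g (x + 2 * PI) = g x) by (intros; apply Q_period; auto).
  pose proof open_W as OW.
  set (C := fun t => RInt (fun x => Q (t, x) * g x) 0 (2 * PI)).
  assert (CC : forall t, 0 < t < T -> continuous C t).
  { intros t Ht.
    apply (continuous_RInt_section W 0 (2 * PI) OW Hpi' (fun p => Q p * g (snd p)) t).
    - intros q Hq. apply (smooth_continuous W); auto.
      pose proof smooth_Q. pose proof (smooth_space _ Sg). smoothness.
    - intros x _; exact Ht. }
  assert (C0 : C t0 <= 0).
  { apply Rnot_lt_le. intros Hpos.
    destruct (CC t0 Ht0 (fun y => 0 < y) (open_gt 0 (C t0) Hpos)) as [e0 He0].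
    pose proof (cond_pos e0).
    set (m := Rmin (e0 / 2) (Rmin (t0 / 2) ((T - t0) / 2))).
    assert (0 < m) by (repeat apply Rmin_glb_lt; lra).
    assert (m <= e0 / 2) by apply Rmin_l.
    assert (m <= t0 / 2) by (eapply Rle_trans; [apply Rmin_r|apply Rmin_l]).
    assert (m <= (T - t0) / 2) by (eapply Rle_trans; [apply Rmin_r|apply Rmin_r]).
    destruct (step_size (t0 - m) (t0 + m) g) as (d & d_pos & step); auto; try lra.
    assert (E : RInt (fun t => (t - (t0 - m)) * (t0 + m - t) * C t) (t0 - m) (t0 + m) = 0).
    { apply (variation_Q (t0 - m) (t0 + m) g) with d; auto; lra. }
    assert (HC : forall t, t0 - m <= t <= t0 + m -> 0 < C t).
    { intros t Ht. apply He0. apply Rabs_def1; unfold minus, plus, opp; simpl; lra. }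
    apply Rlt_irrefl with 0. rewrite <- E at 2. apply RInt_gt_0; [lra| |].
    - intros t Ht. apply Rmult_lt_0_compat; [|apply HC; lra].
      apply Rmult_lt_0_compat; lra.
    - intros t Ht.
      apply (continuous_mult (K := R_AbsRing) (fun t => (t - (t0 - m)) * (t0 + m - t)) C).
      + apply (ex_derive_continuous (V := R_NormedModule)). auto_derive. auto.
      + apply CC; lra. }
  assert (Cg : forall x, continuous g x).
  { intros x. exact (smooth_continuous everywhere g x Sg I). }
  assert (Cgg : forall x, continuous (fun x => g x * g x) x).
  { intros x. apply (continuous_mult (K := R_AbsRing) g g); auto. }
  assert (E : g x0 * g x0 = 0).
  (* A period centred at x0, so that x0 is an interior point. *)
  { apply (RInt_zero_at (fun x => g x * g x) (x0 - PI) (x0 - PI + 2 * PI)); auto; try lra.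
    - intros x. apply Rle_0_sqr.
    - rewrite RInt_periodic; auto. intros x. now rewrite Pg. }
  destruct (Rmult_integral _ _ E); auto.
Qed.

(** The x-derivative of [P] is r^2 r_x; dividing by [nu], which is r times the x-derivative of [e],
    leaves the coefficient [c = r / e_x]. *)
Lemma euler_lagrange (t x : R) : 0 < t < T ->
  D dt (D dt e) (t, x) = - (r (t, x) * / D dx e (t, x)) * D dx r (t, x).
Proof.
  intros Ht. pose proof (euler_lagrange_expression_zero t x Ht) as E. unfold Q, P in E; cbn [snd] in E.
  pose proof open_W. pose proof smooth_lagrangian_density. assert (Wt : W (t, x)) by exact Ht.
  pose proof (e_x_pos _ Wt) as Hq.
  assert (Hn : 0 < nu x) by apply Hnu.
  rewrite (D_mult W (fun _ => / 3)) in E; auto; try smoothness.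
  rewrite (D_mult W (fun p => r p * r p)) in E; auto; try smoothness.
  rewrite (D_mult W r r), (D_const dx (/ 3)) in E; auto.
  assert (Er : r (t, x) = nu x * / D dx e (t, x)) by reflexivity.
  set (q := D dx e (t, x)) in *. set (rr := r (t, x)) in *.
  replace (nu x) with (rr * q) in E by (rewrite Er; field; lra).
  assert (Hr : rr <> 0).
  { rewrite Er. apply Rgt_not_eq, Rmult_lt_0_compat; auto. apply Rinv_0_lt_compat; auto. }
  apply Rmult_eq_reg_l with (rr * q).
  - transitivity (- (rr * rr * D dx r (t, x))); [lra|field; lra].
  - apply Rmult_integral_contrapositive_currified; lra.
Qed.

End EulerLagrange.

(** * Uniqueness for linear conservation laws *)

(** One-sided comparison, because the maximum in the principle below may occur at the final time. *)
Lemma derive_ge0_left_max (f : R -> R) (t l d : R) :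
  is_derive f t l -> 0 < d -> (forall s, t - d <= s <= t -> f s <= f t) -> 0 <= l.
Proof.
  intros Hf Hd Hmax. apply is_derive_Reals in Hf. apply Rnot_lt_le; intros Hl.
  destruct (Hf (- l / 2) ltac:(lra)) as [e He]. pose proof (cond_pos e).
  set (h := Rmin d (e / 2)).
  assert (0 < h) by (apply Rmin_glb_lt; lra).
  assert (h <= d) by apply Rmin_l. assert (h <= e / 2) by apply Rmin_r.
  specialize (He (- h) ltac:(lra)). rewrite Rabs_Ropp, Rabs_right in He by lra.
  specialize (He ltac:(lra)). apply Rabs_def2 in He.
  specialize (Hmax (t + - h) ltac:(lra)).
  assert (0 <= (f (t + - h) - f t) / - h); [|lra].
  replace ((f (t + - h) - f t) / - h) with ((f t - f (t + - h)) * / h) by (field; lra).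
  apply Rmult_le_pos; [lra|]. left; apply Rinv_0_lt_compat; auto.
Qed.

Lemma derive_zero_max (f : R -> R) (t l : R) :
  is_derive f t l -> (forall s, f s <= f t) -> l = 0.
Proof.
  intros Hf Hmax. apply Rle_antisym.
  - assert (0 <= - l); [|lra].
    apply (derive_ge0_left_max (fun s => f (2 * t - s)) t (- l) 1); [|lra|].
    + evar_last.
      * apply (is_derive_comp f (fun s => 2 * t - s)).
        -- replace (2 * t - t) with t by ring. exact Hf.
        -- auto_derive; auto.
      * unfold scal; simpl; unfold mult; simpl. ring.
    + intros s _. replace (2 * t - t) with t by ring. auto.
  - apply (derive_ge0_left_max f t l 1); auto. lra.
Qed.

(* Maximum principle: with [K >= |speed_x|], the function [exp (- (2 K + 1) t) al ^ 2]
   has no positive maximum at a positive time. *)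
Lemma conservation_law_unique (U : R * R -> Prop) (al speed : R * R -> R) (T : R) :
  smooth U al -> smooth U speed -> 0 <= T ->
  (forall t x, 0 <= t <= T -> U (t, x)) ->
  (forall t x, 0 <= t <= T -> al (t, x + 2 * PI) = al (t, x)) ->
  (forall x, al (0, x) = 0) ->
  (forall t x, 0 < t <= T -> D dt al (t, x) = - D dx (fun p => speed p * al p) (t, x)) ->
  forall x, al (T, x) = 0.
Proof.
  intros Sa Ss HT HU Hper H0 Hpde. pose proof PI_RGT_0 as Hpi.
  destruct (bounded_rectangle (fun t x => D dx speed (t, x)) 0 T 0 (2 * PI)) as [K HK].
  { intros t x Ht _. apply continuous_ext with (D dx speed); [intros []; auto|].
    apply (smooth_continuous U); auto. apply smooth_D; auto. }
  set (k := 2 * K + 1).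
  set (ga := fun t x => exp (- (k * t)) * (al (t, x) * al (t, x))).
  assert (Ca : forall t x, 0 <= t <= T -> continuous al (t, x)).
  { intros t x Ht. apply (smooth_continuous U); auto. }
  destruct (max_rectangle ga 0 T 0 (2 * PI)) as (t & x & Ht & Hx & Hmax); try lra.
  { intros t x Ht _. apply (continuous_mult (K := R_AbsRing)
      (fun z : R * R => exp (- (k * fst z))) (fun z : R * R => al (fst z, snd z) * al (fst z, snd z))).
    - apply (continuous_comp fst (fun t => exp (- (k * t)))); [apply continuous_fst|].
      apply (ex_derive_continuous (V := R_NormedModule)). auto_derive; auto.
    - apply continuous_ext with (fun z => al z * al z); [intros []; auto|].
      apply (continuous_mult (K := R_AbsRing) al al); auto. }
  (* Periodicity makes the maximum over one period a maximum over all x, so that the x-derivative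
     vanishes there even at an end of the period. *)
  assert (Hmax' : forall t' x', 0 <= t' <= T -> ga t' x' <= ga t x).
  { intros t' x' Ht'. revert x'. apply periodic_extend.
    - intros y. unfold ga. rewrite Hper; auto.
    - intros y Hy. unfold ga. rewrite <- (Hper t' (y - 2 * PI)); auto.
      replace (y - 2 * PI + 2 * PI) with y by ring. exact Hy.
    - intros y Hy. auto. }
  (* If [al] vanishes at the maximum of the nonnegative [ga], then [ga], and with it [al], vanishes
     throughout. *)
  destruct (Req_dec (al (t, x)) 0) as [Hz|Hz].
  - intros y. specialize (Hmax' T y ltac:(lra)). unfold ga in Hmax'. rewrite Hz in Hmax'.
    pose proof (exp_pos (- (k * T))).
    assert (al (T, y) * al (T, y) <= 0); [|nra].
    apply Rmult_le_reg_l with (exp (- (k * T))); auto. lra.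
  - exfalso.
    assert (Ht0 : 0 < t).
    { destruct (Req_dec t 0) as [E|E]; [|lra]. rewrite E, H0 in Hz. lra. }
    assert (Ht' : 0 <= t <= T) by lra.
    assert (Dx : is_derive (fun y => al (t, y)) x (D dx al (t, x)))
      by (apply is_derive_dx with U; auto).
    assert (Dt : is_derive (fun s => al (s, x)) t (D dt al (t, x)))
      by (apply is_derive_dt with U; auto).
    pose proof (exp_pos (- (k * t))) as Hexp.
    assert (al_x : D dx al (t, x) = 0).
    { assert (E : exp (- (k * t)) * (2 * al (t, x) * D dx al (t, x)) = 0).
      { apply (derive_zero_max (fun y => ga t y) x); auto.
        apply is_derive_scal. evar_last.
        - apply (is_derive_mult (K := R_AbsRing) (fun y => al (t, y)) (fun y => al (t, y)));
            [exact Dx|exact Dx|]. intros; apply Rmult_comm.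
        - unfold plus, mult; simpl. ring. }
      apply Rmult_integral in E. destruct E as [E|E]; [lra|].
      apply Rmult_integral in E. destruct E as [E|E]; [lra|auto]. }
    assert (E : 0 <= exp (- (k * t)) * (- k * (al (t, x) * al (t, x))
                  + 2 * al (t, x) * D dt al (t, x))).
    { apply (derive_ge0_left_max (fun s => ga s x) t _ t); auto.
      - evar_last.
        + apply (is_derive_mult (K := R_AbsRing) (fun s => exp (- (k * s)))
            (fun s => al (s, x) * al (s, x)) t (- k * exp (- (k * t)))).
          * auto_derive; auto. ring.
          * apply (is_derive_mult (K := R_AbsRing) (fun s => al (s, x)) (fun s => al (s, x)));
              [exact Dt|exact Dt|]. intros; apply Rmult_comm.
          * intros; apply Rmult_comm.
        + unfold plus, mult; simpl. ring.
      - intros s Hs. apply Hmax'. lra. }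
    assert (Em : D dt al (t, x) = - (D dx speed (t, x) * al (t, x))).
    { rewrite Hpde by lra. f_equal.
      transitivity (D dx speed (t, x) * al (t, x) + speed (t, x) * D dx al (t, x)).
      - apply (D_mult U); auto.
      - rewrite al_x. ring. }
    rewrite Em in E.
    specialize (HK t x Ht' Hx). apply Rabs_le_between in HK.
    assert (0 < al (t, x) * al (t, x)) by nra.
    (* The bound on the speed gradient costs at most 2 K, so k = 2 K + 1 leaves at most -al^2, which
       is negative. *)
    assert (- k * (al (t, x) * al (t, x)) + 2 * al (t, x) *
      - (D dx speed (t, x) * al (t, x)) < 0).
    { unfold k. nra. }
    nra.
Qed.

(** * Jacobi fields *)

Notation d3t := ((0, 1, 0) : R * R * R).
Notation d3x := ((0, 0, 1) : R * R * R).

Lemma D_comp {V : NormedModule R_AbsRing} (U : V -> Prop) (f : V -> R) (g : R -> R) (h p : V) :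
  smooth U f -> U p -> smooth everywhere g ->
  D h (fun q => g (f q)) p = Derive g (f p) * D h f p.
Proof.
  intros Hf Hp Hg. apply is_derive_unique. evar_last.
  - apply (is_derive_comp g (fun r : R => f (plus p (scal r h)))).
    + apply smooth_is_derive; auto.
    + eapply is_derive_D; eauto.
  - rewrite plus_scal_0. apply Rmult_comm.
Qed.

Definition slice (s : R) (q : R * R) : R * R * R := (s, fst q, snd q).

Lemma continuous_slice (s : R) (q : R * R) : continuous (slice s) q.
Proof.
  destruct q as [t x]. intros P [e He]. exists e. intros [t' x'] [H1 H2].
  apply He. repeat split; auto. apply (ball_center (M := R_UniformSpace)).
Qed.

Lemma slice_line (s : R) (q h : R * R) (y : R) :
  slice s (plus q (scal y h)) = plus (slice s q) (scal y (slice 0 h)).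
Proof.
  destruct q as [t x], h as [h1 h2].
  refine (triple_eq _ _ _ _ _ _ (_ : s = s + y * 0) _ _); auto. ring.
Qed.

Lemma smooth_slice (U : R * R * R -> Prop) (f : R * R * R -> R) (s : R) :
  smooth U f -> smooth (fun q => U (slice s q)) (fun q => f (slice s q)).
Proof.
  apply (smooth_affine (slice s) (slice 0)); [apply continuous_slice|apply slice_line].
Qed.

Lemma D_slice (f : R * R * R -> R) (s h1 h2 : R) :
  D ((h1, h2) : R * R) (fun q => f (slice s q)) = fun q => D (0, h1, h2) f (slice s q).
Proof.
  apply functional_extensionality. intros q.
  exact (D_affine (slice s) (slice 0) (slice_line s) f (h1, h2) q).
Qed.

Section Jacobi.
Variables (nu : R -> R) (Z : R * R * R -> R) (U : R * R * R -> Prop) (T eps : R).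
Hypothesis T_pos : 0 < T.
Hypothesis eps_pos : 0 < eps.
Hypothesis nu_smooth : smooth everywhere nu.
Hypothesis nu_pos : forall x, 0 < nu x.
Hypothesis nu_period : forall x, nu (x + 2 * PI) = nu x.
Hypothesis U_open : open U.
Hypothesis Z_smooth : smooth U Z.
Hypothesis Z_x_pos : forall p, U p -> 0 < D d3x Z p.
Hypothesis U_strip : forall s t x, Rabs s < eps -> 0 <= t < T -> U (s, t, x).

(** The open region where periodicity and the equation of motion are known; [U] also contains a
    neighbourhood of the initial time, so derivatives at t = 0 are available there. *)
Let A (p : R * R * R) : Prop := Rabs (fst (fst p)) < eps /\ 0 < snd (fst p) < T.
Let N (p : R * R * R) : R := nu (snd p).
Let tau (p : R * R * R) : R := snd (fst p).
Let r (p : R * R * R) : R := N p * / D d3x Z p.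
Let c (p : R * R * R) : R := r p * / D d3x Z p.

Hypothesis Z_period : forall s t x, A (s, t, x) -> Z (s, t, x + 2 * PI) = Z (s, t, x) + 2 * PI.
Hypothesis Z_euler : forall p, A p -> D d3t (D d3t Z) p = - c p * D d3x r p.
Hypothesis Z_init : forall x, Z (0, 0, x) = x.
Hypothesis Z_s_init : forall x, D ds Z (0, 0, x) = 0.

Let J : R * R * R -> R := D ds Z.
Let v0 (x : R) : R := D d3t J (0, 0, x).

Lemma A_U p : A p -> U p.
Proof. destruct p as [[s t] x]. intros [H1 H2]. apply U_strip; simpl in *; lra. Qed.

Lemma open_A : open A.
Proof.
  apply open_and; [|apply open_and].
  - apply (open_comp (fun p : R * R * R => Rabs (fst (fst p))) (fun y => y < eps)); [|apply open_lt].
    intros p _. apply (continuous_comp (fun p : R * R * R => fst (fst p)) Rabs).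
    + apply (continuous_comp fst fst); apply continuous_fst.
    + apply continuous_Rabs.
  - apply (open_comp (fun p : R * R * R => snd (fst p)) (fun y => 0 < y)); [|apply open_gt].
    intros p _. apply (continuous_comp fst snd); [apply continuous_fst|apply continuous_snd].
  - apply (open_comp (fun p : R * R * R => snd (fst p)) (fun y => y < T)); [|apply open_lt].
    intros p _. apply (continuous_comp fst snd); [apply continuous_fst|apply continuous_snd].
Qed.

Lemma smooth_N : smooth U N.
Proof.
  apply smooth_subset with (fun p : R * R * R => everywhere (snd p)); [intros; exact I|].
  exact (smooth_snd everywhere nu nu_smooth).
Qed.

Lemma smooth_tau : smooth U tau.
Proof.
  apply smooth_subset with (fun p : R * R * R => everywhere (snd (fst p))); [intros; exact I|].
  exact (smooth_fst _ _ (smooth_snd everywhere _ smooth_id)).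
Qed.

Lemma smooth_Z_x_inv : smooth U (fun p => / D d3x Z p).
Proof.
  apply smooth_inv; auto using smooth_D. intros p Hp. apply Rgt_not_eq, Z_x_pos; auto.
Qed.

Lemma smooth_density : smooth U r.
Proof. apply smooth_mult; auto using smooth_N, smooth_Z_x_inv. Qed.

Lemma smooth_c : smooth U c.
Proof. apply smooth_mult; auto using smooth_density, smooth_Z_x_inv. Qed.

Lemma smooth_J : smooth U J.
Proof. apply smooth_D; auto. Qed.

Lemma D_N h1 h2 p : D ((h1, h2, 0) : R * R * R) N p = 0.
Proof.
  transitivity (Derive (fun _ : R => N p) 0); [|apply Derive_const]. apply Derive_ext. intros y.
  destruct p as [q x]. refine (f_equal nu (_ : x + y * 0 = x)). ring.
Qed.

Lemma D_tau_t p : D d3t tau p = 1.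
Proof.
  apply is_derive_unique. destruct p as [[s t] x].
  apply (is_derive_ext (fun y => t + y * 1)); [reflexivity|]. auto_derive; auto. ring.
Qed.

Lemma D_tau_x p : D d3x tau p = 0.
Proof.
  transitivity (Derive (fun _ : R => tau p) 0); [|apply Derive_const]. apply Derive_ext. intros y.
  destruct p as [[s t] x]. refine (_ : t + y * 0 = t). ring.
Qed.

Lemma r_Z_x p : U p -> r p * D d3x Z p = N p.
Proof. intros Hp. unfold r. field. apply Rgt_not_eq, Z_x_pos; auto. Qed.

Lemma c_Z_x p : U p -> c p * D d3x Z p = r p.
Proof. intros Hp. unfold c. field. apply Rgt_not_eq, Z_x_pos; auto. Qed.

Lemma r_pos p : U p -> 0 < r p.
Proof. intros Hp. apply Rmult_lt_0_compat; [apply nu_pos|apply Rinv_0_lt_compat; auto]. Qed.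

(** Differentiates [r * Z_x = N] in a direction without x-component, in which the mass density [N]
    is constant. It serves both t and s. *)
Lemma D_r h1 h2 p : U p ->
  D ((h1, h2, 0) : R * R * R) r p = - c p * D (h1, h2, 0) (D d3x Z) p.
Proof.
  intros Hp. pose proof smooth_density as Sr. pose proof (smooth_D U Z d3x Z_smooth) as Sx.
  pose proof (D_N h1 h2 p) as E.
  rewrite <- (D_ext U (fun p => r p * D d3x Z p) N) in E; auto using r_Z_x.
  rewrite (D_mult U) in E; auto. pose proof (Z_x_pos p Hp). pose proof (c_Z_x p Hp) as Ec.
  rewrite <- Ec in E. apply Rmult_eq_reg_r with (D d3x Z p); [|lra].
  rewrite Rmult_assoc, (Rmult_comm _ (D d3x Z p)).
  rewrite <- Rmult_assoc, Ropp_mult_distr_l_reverse. lra.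
Qed.

Lemma D_c h1 h2 p : U p ->
  D ((h1, h2, 0) : R * R * R) c p * D d3x Z p = - 2 * c p * D (h1, h2, 0) (D d3x Z) p.
Proof.
  intros Hp. pose proof smooth_c as Sc. pose proof (smooth_D U Z d3x Z_smooth) as Sx.
  pose proof (D_r h1 h2 p Hp) as E.
  rewrite <- (D_ext U (fun p => c p * D d3x Z p) r) in E; auto using c_Z_x.
  rewrite (D_mult U) in E; auto. lra.
Qed.

(** In Eulerian terms [M] is [Z_x] times the velocity perturbation [v] evaluated at [Z], since v =
    j_t + u j_x - j u_x. Likewise the x-derivative of [RJ] is -[Z_x] times the density perturbation
    [sigma] at [Z]. Hence [M] minus or plus that derivative represents v + sigma or v - sigma, the
    perturbed invariants. *)
Let M (p : R * R * R) : R := D d3x Z p * D d3t J p - D d3t (D d3x Z) p * J p.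
Let RJ (p : R * R * R) : R := r p * J p.

Lemma smooth_M : smooth U M.
Proof. pose proof smooth_J. unfold M. smoothness. Qed.

Lemma smooth_RJ : smooth U RJ.
Proof. pose proof smooth_J. pose proof smooth_density. unfold RJ. smoothness. Qed.

(** The linearized continuity equation, integrated once in x: a kinematic identity that does not
    involve the equation of motion. *)
Lemma RJ_t p : U p -> D d3t RJ p = c p * M p.
Proof.
  intros Hp. pose proof smooth_J. pose proof smooth_density.
  unfold RJ. rewrite (D_mult U) by auto. rewrite D_r by auto. unfold M.
  rewrite <- (c_Z_x p Hp). ring.
Qed.

Lemma RJ_x_t p : U p -> D d3t (D d3x RJ) p = D d3x (fun p => c p * M p) p.
Proof.
  intros Hp. rewrite (D_comm U) by auto using smooth_RJ.
  apply (D_ext U); auto using RJ_t.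
Qed.

(** The products of [Z_xt] and [J_t] cancel, leaving [Z_x * J_tt - Z_xtt * J]. The two second time
    derivatives are the s- and x-derivatives of the equation of motion ([E1], [E2]). *)
Lemma M_t p : A p -> D d3t M p = D d3x (fun p => c p * D d3x RJ p) p.
Proof.
  intros HA. pose proof (A_U p HA) as Hp. pose proof open_A as OA.
  pose proof smooth_J as SJ. pose proof smooth_density as Sr. pose proof smooth_c as Sc.
  assert (SA : forall f, smooth U f -> smooth A f).
  { intros f Hf. apply smooth_subset with U; auto using A_U. }
  assert (E1 : D d3t (D d3t J) p = - (D ds c p * D d3x r p + c p * D ds (D d3x r) p)).
  { unfold J.
    rewrite (D_ext U (D d3t (D ds Z)) (D ds (D d3t Z)) d3t) by (auto; intros; now apply (D_comm U)).
    rewrite (D_comm U) by (auto; smoothness).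
    rewrite (D_ext A _ (fun p => - (c p * D d3x r p)) ds); auto.
    - rewrite D_opp, (D_mult U); auto; smoothness.
    - intros q Hq. rewrite Z_euler; auto. ring. }
  assert (E2 : D d3t (D d3t (D d3x Z)) p = - (D d3x c p * D d3x r p + c p * D d3x (D d3x r) p)).
  { rewrite (D_ext U (D d3t (D d3x Z)) (D d3x (D d3t Z)) d3t) by (auto; intros; now apply (D_comm U)).
    rewrite (D_comm U) by (auto; smoothness).
    rewrite (D_ext A _ (fun p => - (c p * D d3x r p)) d3x); auto.
    - rewrite D_opp, (D_mult U); auto; smoothness.
    - intros q Hq. rewrite Z_euler; auto. ring. }
  assert (Esx : forall q, U q -> D ds (D d3x Z) q = D d3x J q).
  { intros q Hq. apply (D_comm U); auto. }
  assert (E3 : D ds (D d3x r) p = - (D d3x c p * D d3x J p + c p * D d3x (D d3x J) p)).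
  { rewrite (D_comm U) by auto.
    rewrite (D_ext U _ (fun p => - (c p * D d3x J p)) d3x); auto.
    - rewrite D_opp, (D_mult U); auto; smoothness.
    - intros q Hq. rewrite D_r, Esx; auto. ring. }
  assert (E4 : D ds c p * D d3x Z p = - 2 * c p * D d3x J p).
  { rewrite D_c, Esx; auto. }
  assert (ER : forall q, U q -> D d3x RJ q = D d3x r q * J q + r q * D d3x J q).
  { intros q Hq. unfold RJ. rewrite (D_mult U); auto. }
  assert (ERx : D d3x (D d3x RJ) p =
     D d3x (D d3x r) p * J p + 2 * D d3x r p * D d3x J p + r p * D d3x (D d3x J) p).
  { rewrite (D_ext U _ _ d3x p U_open ER Hp).
    rewrite (D_plus U) by (auto; smoothness).
    rewrite !(D_mult U) by (auto; smoothness). ring. }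
  rewrite (D_mult U) by (auto; try smoothness; apply smooth_RJ).
  rewrite ERx, ER by auto.
  unfold M. rewrite (D_minus U) by (auto; smoothness).
  rewrite !(D_mult U) by (auto; smoothness).
  rewrite E1, E2, E3. rewrite <- (c_Z_x p Hp).
  (* Brings the s-derivative of [c] next to [Z_x], the only combination in which [E4] knows it. *)
  replace (D d3x Z p * - (D ds c p * D d3x r p + c p * - (D d3x c p * D d3x J p + c p * D d3x (D d3x J) p)))
   with (- (D ds c p * D d3x Z p) * D d3x r p
     + c p * D d3x Z p * (D d3x c p * D d3x J p + c p * D d3x (D d3x J) p)) by ring.
  rewrite E4. ring.
Qed.

(** * The two families of characteristics, for [sg] equal to 1 and -1 *)

Section Characteristic.
Variable sg : R.
Hypothesis sg_sqr : sg * sg = 1.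

Let k (p : R * R * R) : R := sg * c p.
(** Along a curve with x-velocity [k] the image under [Z] moves at Z_t + k Z_x = Z_t + sg r. This
    value is constant along the curve, so the image is a straight line and [a] is its starting
    point. *)
Let a (p : R * R * R) : R := Z p - tau p * (D d3t Z p + sg * r p).

Lemma smooth_a : smooth U a.
Proof. pose proof smooth_density. pose proof smooth_tau. unfold a. smoothness. Qed.

Lemma smooth_k : smooth U k.
Proof. pose proof smooth_c. unfold k. smoothness. Qed.

Lemma a_x p : U p -> D d3x a p = D d3x Z p - tau p * (D d3t (D d3x Z) p + sg * D d3x r p).
Proof.
  intros Hp. pose proof smooth_density as Sr. pose proof smooth_tau as St.
  unfold a. rewrite (D_minus U), (D_mult U), (D_plus U), (D_mult U) by (auto; smoothness).
  rewrite D_const, D_tau_x, (D_comm U) by auto. ring.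
Qed.

(** Here [sg * sg = 1] matches the pressure term of the equation of motion with [k] times
    [sg * r_x]. *)
Lemma a_t p : A p -> D d3t a p = - (k p * D d3x a p).
Proof.
  intros HA. pose proof (A_U p HA) as Hp. rewrite a_x by auto.
  pose proof smooth_density as Sr. pose proof smooth_tau as St.
  unfold a, k. rewrite (D_minus U), (D_mult U), (D_plus U), (D_mult U) by (auto; smoothness).
  rewrite D_const, D_tau_t, Z_euler, D_r, <- (c_Z_x p Hp) by auto.
  replace (- (sg * c p * (D d3x Z p - tau p * (D d3t (D d3x Z) p + sg * D d3x r p)))) with
    (- (sg * c p * (D d3x Z p - tau p * D d3t (D d3x Z) p)) + (sg * sg) * c p * tau p * D d3x r p)
    by ring.
  rewrite sg_sqr. ring.
Qed.

(** For an antiderivative V of [v], V(a) is transported with speed [k]; the x-derivative of a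
    transported quantity is a conserved density. *)
Lemma transported_density (v : R -> R) p : smooth everywhere v -> A p ->
  D d3t (fun p => v (a p) * D d3x a p) p = - D d3x (fun p => k p * (v (a p) * D d3x a p)) p.
Proof.
  intros Sv HA. pose proof (A_U p HA) as Hp. pose proof open_A as OA.
  pose proof smooth_a as Sa. pose proof smooth_k as Sk.
  assert (Sva : smooth U (fun p => v (a p))).
  { apply (smooth_comp U everywhere); auto. intros; exact I. }
  assert (E : D d3t (D d3x a) p = - (D d3x k p * D d3x a p + k p * D d3x (D d3x a) p)).
  { rewrite (D_comm U) by auto.
    rewrite (D_ext A _ (fun p => - (k p * D d3x a p)) d3x); auto using a_t.
    rewrite D_opp, (D_mult U); auto; smoothness. }
  rewrite !(D_mult U) by (auto; smoothness).
  rewrite !(D_comp U) by auto. rewrite E, a_t by auto. ring.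
Qed.

Let al (p : R * R * R) : R := M p - sg * D d3x RJ p - v0 (a p) * D d3x a p.

Lemma smooth_v0 : smooth everywhere v0.
Proof.
  apply smooth_subset with (fun x : R => U (0, 0, x)).
  - intros x _. apply U_strip; [rewrite Rabs_R0|]; lra.
  - apply (smooth_section U (D d3t J) (0, 0)). apply smooth_D, smooth_J.
Qed.

Lemma smooth_v0_a : smooth U (fun p => v0 (a p)).
Proof.
  apply (smooth_comp U everywhere); auto using smooth_a, smooth_v0. intros; exact I.
Qed.

Lemma smooth_al : smooth U al.
Proof.
  pose proof smooth_M. pose proof smooth_RJ. pose proof smooth_a. pose proof smooth_v0_a.
  unfold al. smoothness.
Qed.

(** The fluxes of [M] and of the x-derivative of [RJ] are exchanged by the two equations, so the
    combination with [sg] is an eigenvector: [sg * sg = 1] turns its flux into [k] times itself. *)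
Lemma al_conserved p : A p -> D d3t al p = - D d3x (fun p => k p * al p) p.
Proof.
  intros HA. pose proof (A_U p HA) as Hp.
  pose proof smooth_M as SM. pose proof smooth_RJ as SR. pose proof smooth_a as Sa.
  pose proof smooth_v0_a as Sv. pose proof smooth_c as Sc. pose proof smooth_k as Sk.
  pose proof (transported_density v0 p smooth_v0 HA) as E.
  rewrite (D_ext U (fun p => k p * al p) (fun p => sg * (c p * M p) - c p * D d3x RJ p
     - k p * (v0 (a p) * D d3x a p)) d3x p); auto.
  - rewrite !(D_minus U) by (auto; smoothness).
    rewrite (D_mult U (fun _ => sg)) by (auto; smoothness).
    rewrite D_const. unfold al.
    rewrite !(D_minus U) by (auto; smoothness).
    rewrite E, M_t by auto.
    rewrite (D_mult U (fun _ => sg)) by (auto; smoothness).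
    rewrite D_const, RJ_x_t by auto. ring.
  - intros q Hq. unfold al, k.
    replace (c q * D d3x RJ q) with ((sg * sg) * c q * D d3x RJ q) by (rewrite sg_sqr; ring).
    ring.
Qed.

Lemma D_period3 (f : R * R * R -> R) (h : R * R * R) (l s t x : R) :
  (forall s t x, A (s, t, x) -> f (s, t, x + 2 * PI) = f (s, t, x) + l) ->
  A (s, t, x) -> D h f (s, t, x + 2 * PI) = D h f (s, t, x).
Proof.
  intros Hf HA.
  assert (E : forall s t x : R, plus (s, t, x) (0, 0, 2 * PI) = (s, t, x + 2 * PI)).
  { intros s' t' x'. change ((s' + 0, t' + 0, x' + 2 * PI) = (s', t', x' + 2 * PI)).
    now rewrite !Rplus_0_r. }
  rewrite <- E. apply (D_shift A f h (0, 0, 2 * PI) l); auto using open_A.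
  intros [[s' t'] x'] Hq. transitivity (f (s', t', x' + 2 * PI)); [apply f_equal, E|auto].
Qed.

Let periodic (f : R * R * R -> R) : Prop :=
  forall s t x, A (s, t, x) -> f (s, t, x + 2 * PI) = f (s, t, x).

Lemma periodic_D f h : periodic f -> periodic (D h f).
Proof.
  intros Hf s t x HA. apply D_period3 with 0; auto.
  intros. rewrite Rplus_0_r. auto.
Qed.

Lemma periodic_D_Z h : periodic (D h Z).
Proof. intros s t x HA. apply D_period3 with (2 * PI); auto. Qed.

Lemma periodic_r : periodic r.
Proof.
  intros s t x HA. unfold r, N. rewrite periodic_D_Z by auto. cbn [snd]. now rewrite nu_period.
Qed.

Lemma periodic_J : periodic J.
Proof. apply periodic_D_Z. Qed.

Lemma periodic_RJ : periodic RJ.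
Proof. intros s t x HA. unfold RJ. now rewrite periodic_r, periodic_J by auto. Qed.

Lemma periodic_M : periodic M.
Proof.
  intros s t x HA. unfold M.
  now rewrite periodic_D_Z, (periodic_D _ d3t periodic_J), periodic_J,
    (periodic_D _ d3t (periodic_D_Z d3x)) by auto.
Qed.

Lemma a_period (s t x : R) : A (s, t, x) -> a (s, t, x + 2 * PI) = a (s, t, x) + 2 * PI.
Proof.
  intros HA. unfold a. rewrite Z_period, periodic_D_Z, periodic_r by auto.
  unfold tau; cbn [fst snd]. ring.
Qed.

(* [t = 0] lies on the boundary of the region of periodicity. *)
Lemma v0_period x : v0 (x + 2 * PI) = v0 x.
Proof.
  set (f := fun t => D d3t J (0, t, x + 2 * PI) - D d3t J (0, t, x)).
  assert (Cont : continuous f 0).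
  { assert (C1 : forall y : R, continuous (fun t : R => D d3t J (0, t, y)) 0).
    { intros y. apply (continuous_comp (fun t : R => (0, t, y)) (D d3t J)).
      - intros P [e He]. exists e. intros t Ht. apply He. repeat split; auto;
          simpl; apply (ball_center (M := R_UniformSpace)).
      - apply (smooth_continuous U); [apply smooth_D, smooth_J|].
        apply U_strip; [rewrite Rabs_R0|]; lra. }
    apply (continuous_minus (V := R_NormedModule) (fun t : R => D d3t J (0, t, x + 2 * PI))); auto. }
  assert (E : f 0 = 0); [|apply Rminus_diag_uniq; exact E].
  apply NNPP. intros Hne.
  destruct (Cont (fun y => y <> 0) (open_neq0 _ Hne)) as [e He]. pose proof (cond_pos e).
  set (m := Rmin (e / 2) (T / 2)).
  assert (0 < m) by (apply Rmin_glb_lt; lra).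
  assert (m <= e / 2) by apply Rmin_l. assert (m <= T / 2) by apply Rmin_r.
  apply (He m).
  - apply Rabs_def1; unfold minus, plus, opp; simpl; lra.
  - apply Rminus_diag_eq. apply (periodic_D _ d3t periodic_J).
    split; simpl; [rewrite Rabs_R0|]; lra.
Qed.

Lemma periodic_al : periodic al.
Proof.
  intros s t x HA. unfold al.
  rewrite periodic_M, (periodic_D _ d3x periodic_RJ), a_period, v0_period by auto.
  rewrite (D_period3 a d3x (2 * PI)) by auto using a_period. reflexivity.
Qed.

Lemma U_init x : U (0, 0, x).
Proof. apply U_strip; [rewrite Rabs_R0|]; lra. Qed.

Lemma D_x_Derive (f : R * R * R -> R) (s t x : R) :
  D d3x f (s, t, x) = Derive (fun x => f (s, t, x)) x.
Proof.
  symmetry. apply (Derive_path f (fun x => (s, t, x))). intros y.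
  change ((s, t, x + y) = (s + y * 0, t + y * 0, x + y * 1)).
  apply triple_eq; ring.
Qed.

Lemma Z_x_init x : D d3x Z (0, 0, x) = 1.
Proof.
  rewrite D_x_Derive. rewrite (Derive_ext _ (fun x => x)) by apply Z_init. apply Derive_id.
Qed.

Lemma a_init x : a (0, 0, x) = x.
Proof. unfold a, tau; cbn [fst snd]. rewrite Z_init. ring. Qed.

Lemma J_init x : J (0, 0, x) = 0.
Proof. apply Z_s_init. Qed.

Lemma RJ_x_init x : D d3x RJ (0, 0, x) = 0.
Proof.
  rewrite D_x_Derive. rewrite (Derive_ext _ (fun _ => 0)); [apply Derive_const|].
  intros y. unfold RJ. rewrite J_init. ring.
Qed.

(** At t = 0 the map is the identity and [J] vanishes, so [M] reduces to [v0], [a] to x and its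
    x-derivative to 1. *)
Lemma al_init x : al (0, 0, x) = 0.
Proof.
  unfold al. rewrite RJ_x_init, a_init, a_x by apply U_init.
  unfold M, tau; cbn [fst snd]. rewrite Z_x_init, J_init. unfold v0. ring.
Qed.

Lemma al_zero (t x : R) : 0 <= t < T -> al (0, t, x) = 0.
Proof.
  intros Ht.
  apply (conservation_law_unique (fun q => U (slice 0 q)) (fun q => al (slice 0 q))
    (fun q => k (slice 0 q)) t).
  - apply smooth_slice, smooth_al.
  - apply smooth_slice, smooth_k.
  - lra.
  - intros t1 y Ht1. apply U_strip; simpl; [rewrite Rabs_R0|]; lra.
  - intros t' y Ht'. unfold slice; cbn [fst snd].
    (* The initial time lies outside [A], but [al] is known to vanish there. *)
    destruct (Req_dec t' 0) as [->|Hne]; [now rewrite !al_init|].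
    apply periodic_al. split; simpl; [rewrite Rabs_R0|]; lra.
  - apply al_init.
  - intros t' y Ht'. rewrite D_slice, (D_slice (fun p => k p * al p)).
    apply al_conserved. split; simpl; [rewrite Rabs_R0|]; lra.
Qed.

End Characteristic.

(** * From the conserved densities to the pointwise bound *)

Lemma is_derive_time (f : R * R * R -> R) (s t x : R) :
  smooth U f -> U (s, t, x) -> is_derive (fun t => f (s, t, x)) t (D d3t f (s, t, x)).
Proof.
  intros Hf HU. apply (is_derive_path U f (fun t => (s, t, x))); auto. intros y.
  change ((s, t + y, x) = (s + y * 0, t + y * 1, x + y * 0)). apply triple_eq; ring.
Qed.

Lemma jacobi_bound (m t x : R) :
  (forall x, Rabs (v0 x) <= m) -> 0 <= t < T -> Rabs (D ds Z (0, t, x)) <= t * m.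
Proof.
  intros Hm Ht.
  set (a := fun p => Z p - tau p * (D d3t Z p + 1 * r p)).
  set (b := fun p => Z p - tau p * (D d3t Z p + -1 * r p)).
  assert (E1 : 1 * 1 = 1) by ring. assert (E2 : -1 * -1 = 1) by ring.
  assert (Hstrip : forall s, 0 <= s <= t -> U (0, s, x)).
  { intros s Hs. apply U_strip; [rewrite Rabs_R0|]; lra. }
  set (V := fun y => RInt v0 0 y).
  assert (Cv : forall y, continuous v0 y).
  { intros y. exact (smooth_continuous everywhere v0 y smooth_v0 I). }
  assert (DV : forall y, is_derive V y (v0 y)).
  { intros y. apply (is_derive_RInt v0 V 0 y); auto. apply filter_forall. intros z.
    apply (RInt_correct (V := R_CompleteNormedModule)),
      (ex_RInt_continuous (V := R_CompleteNormedModule)). auto. }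
  set (Th := fun s => 2 * RJ (0, s, x) - (V (b (0, s, x)) - V (a (0, s, x)))).
  assert (DTh : forall s, 0 <= s <= t -> is_derive Th s
     (2 * D d3t RJ (0, s, x) - (D d3t b (0, s, x) * v0 (b (0, s, x))
       - D d3t a (0, s, x) * v0 (a (0, s, x))))).
  { intros s Hs. pose proof (Hstrip s Hs) as Us.
    apply (is_derive_minus (V := R_NormedModule) (fun s => 2 * RJ (0, s, x))).
    - apply is_derive_scal, is_derive_time; auto. apply smooth_RJ.
    - apply (is_derive_minus (V := R_NormedModule) (fun s => V (b (0, s, x)))).
      + apply (is_derive_comp V (fun s => b (0, s, x))); auto.
        apply is_derive_time; auto. apply (smooth_a (-1)).
      + apply (is_derive_comp V (fun s => a (0, s, x))); auto.
        apply is_derive_time; auto. apply (smooth_a 1). }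
  assert (Eint : 2 * RJ (0, t, x) = V (b (0, t, x)) - V (a (0, t, x))).
  { assert (E0 : Th 0 = 0).
    { unfold Th, b, a, RJ. rewrite J_init, (a_init 1), (a_init (-1)). ring. }
    destruct (MVT_gen Th 0 t (fun s => 0)) as (y & _ & E).
    (* The derivative of [Th] vanishes on the open interval, where the equations hold; the mean
       value theorem needs only continuity at time 0. *)
    - rewrite Rmin_left, Rmax_right by lra. intros s Hs.
      assert (HA : A (0, s, x)) by (split; simpl; [rewrite Rabs_R0|]; lra).
      evar_last; [apply DTh; lra|].
      rewrite RJ_t by (apply Hstrip; lra).
      unfold a, b. rewrite (a_t 1 E1), (a_t (-1) E2) by auto.
      pose proof (al_zero 1 E1 s x ltac:(lra)) as A1.
      pose proof (al_zero (-1) E2 s x ltac:(lra)) as A2.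
      (* Adding the identities for the two signs eliminates the x-derivative of [RJ]. *)
      replace (M (0, s, x)) with
       (/ 2 * (v0 (a (0, s, x)) * D d3x a (0, s, x) + v0 (b (0, s, x)) * D d3x b (0, s, x)))
       by (unfold a, b; lra).
      unfold a, b. field.
    - rewrite Rmin_left, Rmax_right by lra. intros s Hs.
      apply continuity_pt_filterlim. apply (ex_derive_continuous (V := R_NormedModule)).
      eexists. apply DTh; auto.
    - unfold Th in E at 1. lra. }
  assert (Ut : U (0, t, x)) by (apply Hstrip; lra).
  pose proof (r_pos _ Ut) as Hr.
  assert (Eba : b (0, t, x) - a (0, t, x) = 2 * t * r (0, t, x)).
  { unfold a, b, tau; cbn [fst snd]. ring. }
  (* The mean value theorem gives the exact form [J = t * v0 y] for some y; cancelling 2r > 0 also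
     works at t = 0, where both feet coincide. *)
  destruct (MVT_gen V (a (0, t, x)) (b (0, t, x)) v0) as (y & _ & E).
  - intros; apply DV.
  - intros y _. apply continuity_pt_filterlim. apply (ex_derive_continuous (V := R_NormedModule)).
    eexists; apply DV.
  - rewrite Eba in E. rewrite E in Eint. unfold RJ in Eint.
    change (D ds Z (0, t, x)) with (J (0, t, x)).
    replace (J (0, t, x)) with (v0 y * t).
    + rewrite Rabs_mult, (Rabs_right t) by lra. rewrite Rmult_comm.
      apply Rmult_le_compat_l; [lra|apply Hm].
    + apply Rmult_eq_reg_l with (2 * r (0, t, x)); lra.
Qed.

End Jacobi.

Theorem theorem4p2
    (nu : R -> R) (Hnu : volume_density nu)
    (lambda : R -> R)
    (Hlambda_smooth : smooth_on (fun r : R => 0 < r) lambda)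
    (Hlambda_pos : forall r, 0 < r -> 0 < lambda r)
    (Hpressure : forall r, 0 < r -> pressure lambda r = r ^ 3 / 3)
    (T : R) (HT : 0 < T)
    (eta F : R -> R -> R)
    (Hgeod : barotropic_geodesic nu lambda T (fun t => (eta t, F t)))
    (eps : R) (Heps : 0 < eps)
    (zeta : R -> R -> point)
    (Hzeta : barotropic_variation nu lambda T eps (fun t => (eta t, F t)) zeta)
    (J : R -> tangent) (HJ : forall t, J t = variation_field zeta t)
    (j G : R -> R -> R)
    (HjG : forall t x, 0 <= t < T ->
       fst (J t) x = j t (eta t x) /\ snd (J t) x = G t x)
    (v0 : R -> R)
    (HJ0 : forall x, fst (J 0) x = 0 /\ snd (J 0) x = 0)
    (HJ'0 : forall x, fst (velocity J 0) x = v0 x /\ snd (velocity J 0) x = 0) :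
  forall t, 0 <= t < T ->
    Rbar_le (Linf_norm (j t)) (Rbar_mult (Finite t) (Linf_norm v0)).
Proof.
  intros t Ht.
  destruct Hzeta as [[(U3 & OU3 & HU3 & SZ) _] [Hbaro [Hz0 Hinit]]].
  set (Z := fun p : R * R * R => fst (zeta (fst (fst p)) (snd (fst p))) (snd p)).
  change (smooth U3 Z) in SZ.
  (* The extension of [Z] beyond the strip may lose a positive x-derivative, so the domain is cut
     down to the open set where it persists. *)
  set (U := fun p => U3 p /\ 0 < D d3x Z p).
  assert (OU : open U).
  { intros p [H1 H2]. apply filter_and; [apply OU3; auto|].
    apply (smooth_continuous U3 _ p (smooth_D _ _ d3x SZ) H1 (fun y => 0 < y)).
    apply (open_gt 0); auto. }
  assert (SZU : smooth U Z) by (apply smooth_subset with (2 := SZ); intros p []; auto).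
  assert (Hstrip : forall s t x, Rabs s < eps -> 0 <= t < T -> U (s, t, x)).
  { intros s' t' x Hs Ht'. split; [apply HU3; auto|].
    rewrite D_x_Derive. destruct (Hbaro s' Hs) as [[_ [Hconf _]] _].
    apply (circle_diffeo_elim _ (proj1 (Hconf t' Ht'))). }
  assert (Sn : smooth everywhere nu) by (apply (smooth_nu nu); auto).
  assert (EJ : forall t x, fst (J t) x = D ds Z (0, t, x)).
  { intros t' x. rewrite HJ. unfold variation_field; cbn [fst].
    apply (Derive_path Z (fun s => (s, t', x))). intros y.
    change ((0 + y, t', x) = (0 + y * 1, t' + y * 0, x + y * 0)). apply triple_eq; ring. }
  assert (Ev : forall x, v0 x = D d3t (D ds Z) (0, 0, x)).
  { intros x. rewrite <- (proj1 (HJ'0 x)). unfold velocity; cbn [fst].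
    rewrite (Derive_ext _ (fun t => D ds Z (0, t, x))) by (intros; apply EJ).
    apply (Derive_path (D ds Z) (fun t => (0, t, x))). intros y.
    change ((0, 0 + y, x) = (0 + y * 0, 0 + y * 1, x + y * 0)). apply triple_eq; ring. }
  (* The bound is obtained at points [eta t x]; surjectivity of [eta t] makes it a bound on [j t]
     everywhere. *)
  assert (Hsurj : forall y, exists x, eta t x = y).
  { destruct Hgeod as [[_ [Hconf _]] _].
    destruct (circle_diffeo_elim _ (proj1 (Hconf t Ht))) as (S1 & S2 & S3).
    apply lift_surjective; auto. }
  assert (Ej : forall x, j t (eta t x) = D ds Z (0, t, x)).
  { intros x. rewrite <- EJ. symmetry. apply HjG; auto. }
  assert (HZ0 : forall x, D ds Z (0, 0, x) = 0).
  { intros x. rewrite <- EJ. apply HJ0. }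
  assert (Cv : forall x, continuous v0 x).
  { intros x. apply continuous_ext with (fun x => D d3t (D ds Z) ((0, 0), x)).
    { intros; symmetry; apply Ev. }
    apply (continuous_section (D d3t (D ds Z))).
    apply (smooth_continuous U).
    - apply smooth_D, smooth_D, SZU.
    - apply Hstrip; [rewrite Rabs_R0|]; lra. }
  apply Linf_norm_scale; auto.
  - lra.
  - intros E y. destruct (Hsurj y) as [x <-]. rewrite Ej, E. apply HZ0.
  - intros m Hm y. destruct (Hsurj y) as [x <-]. rewrite Ej.
    apply (jacobi_bound nu Z U T eps); auto.
    + apply Hnu.
    + apply Hnu.
    + intros p [_ Hp]; auto.
    + intros s' t' y [Hs Ht']. destruct (Hbaro s' Hs) as [[_ [Hconf _]] _].
      simpl in *. apply (circle_diffeo_elim _ (proj1 (Hconf t' ltac:(lra)))).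
    + intros [[s' t'] y] [Hs Ht']. simpl in Hs, Ht'.
      pose proof (euler_lagrange nu lambda T (zeta s') Hnu Hlambda_smooth Hlambda_pos Hpressure
        (Hbaro s' Hs) t' y Ht') as E.
      (* Each [zeta s'] is a geodesic with its own equation in (t, x); read as a slice of [Z], it
         becomes the equation in (s, t, x) that can be differentiated in s. *)
      change (fun p : R * R => fst (zeta s' (fst p)) (snd p)) with (fun q => Z (slice s' q)) in E.
      rewrite !D_slice in E.
      change (fun p : R * R => nu (snd p) * / D d3x Z (slice s' p)) with
        (fun q => (fun p : R * R * R => nu (snd p) * / D d3x Z p) (slice s' q)) in E.
      rewrite !D_slice in E. exact E.
    + intros y. unfold Z; cbn [fst snd].
      apply (Hinit 0). rewrite Rabs_R0; auto.
    + intros y. rewrite <- Ev. auto.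
Qed.
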